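(* Let $S, S_1, S_2$ be finite-dimensional semi-simple $\mathbb{C}$-algebras with embeddings $S \hookrightarrow S_1$ and $S \hookrightarrow S_2$, and let $A = S_1 \ast_S S_2$ be the amalgamated coproduct. Let $\Lambda$ be the associated bipartite quiver with Euler form $\chi_\Lambda$, let $\mathrm{comp} \subset \mathbb{N}^{s+t}$ be the semigroup consisting of all $\theta$-semi-stable dimension vectors of $\Lambda$, and let $\{\beta_1,\dots,\beta_k\}$ be its set of semigroup generators. Then the quiver setting $(Q_A,\alpha_A)$ associated to $A$ is given by the quiver $Q_A$ on $k$ vertices, corresponding to $\beta_1,\dots,\beta_k$, in which the number of directed arrows from vertex $i$ to vertex $j$ is $$\delta_{ij} - \chi_\Lambda(\beta_i,\beta_j),$$ and the dimension vector $\alpha_A = (n_1,\dots,n_k) \in \mathbb{N}^k$ is determined by $$n_i = \sum_{j=1}^s l_j\, p_j(i) \qquad\text{if}\qquad \beta_i = (p_1(i),\dots,p_s(i);q_1(i),\dots,q_t(i)).$$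
   Context: All algebras are associative $\mathbb{C}$-algebras with unit. $S_1 \ast_S S_2$ denotes the amalgamated coproduct, i.e. the algebra representing the functor $\mathrm{Hom}_{S\text{-alg}}(S_1,-)\times\mathrm{Hom}_{S\text{-alg}}(S_2,-)$ on $S$-algebras; it is a formally smooth algebra (algebra morphisms from it lift modulo nilpotent ideals). Quiver setting of a formally smooth affine algebra $A$. The scheme $\mathrm{rep}_n A$ of $n$-dimensional representations is a smooth variety; its connected components are denoted $\mathrm{rep}_\beta A$ with formal symbols $\beta$, and one writes $|\beta| = n$. Direct sum of representations induces a semigroup structure on the collection of all these symbols (over all $n\in\mathbb{N}$). The vertices of $Q_A$ are in one-to-one correspondence with the semigroup generators $\beta_1,\dots,\beta_k$ of this semigroup. The number of arrows from vertex $i$ to vertex $j$ is $\mathrm{ext}(\beta_i,\beta_j)$, the minimal dimension of $\mathrm{Ext}^1_A(X,X')$ with $X \in \mathrm{rep}_{\beta_i}A$ and $X' \in \mathrm{rep}_{\beta_j}A$. The dimension vector $\alpha_A$ has $i$-th component $|\beta_i|$. The quiver $\Lambda$. Let $U_1,\dots,U_r$ be the simple $S$-modules, $V_1,\dots,V_s$ the simple $S_1$-modules, of dimensions $l_1,\dots,l_s$, and $W_1,\dots,W_t$ the simple $S_2$-modules, of dimensions $m_1,\dots,m_t$. Let $a_{ki}, b_{kj}\in\mathbb{N}$ be defined by $V_i\downarrow_S \simeq \bigoplus_k U_k^{\oplus a_{ki}}$ and $W_j\downarrow_S \simeq \bigoplus_k U_k^{\oplus b_{kj}}$, and put $n_{ij}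 = \dim_{\mathbb{C}}\mathrm{Hom}_S(V_i,W_j) = \sum_{k=1}^r a_{ki}b_{kj}$. $\Lambda$ is the bipartite quiver with $s$ left and $t$ right vertices and exactly $n_{ij}$ arrows from the $i$-th left vertex to the $j$-th right vertex (and no other arrows). Its Euler form is the bilinear form on $\mathbb{Z}^{s+t}$ given by $$\chi_\Lambda\big((p;q),(p';q')\big) = \sum_{i=1}^s p_ip'_i + \sum_{j=1}^t q_jq'_j - \sum_{i=1}^s\sum_{j=1}^t n_{ij}\,p_i q'_j .$$ The semigroup $\mathrm{comp}$. Let $\theta=(-l_1,\dots,-l_s;m_1,\dots,m_t)$. A representation $V$ of $\Lambda$ is $\theta$-semi-stable if it has no proper subrepresentation of dimension vector $\beta$ with $\theta\cdot\beta<0$. Then $\mathrm{comp}$ is the set of all $\alpha=(p_1,\dots,p_s;q_1,\dots,q_t)\in\mathbb{N}^{s+t}$ such that (1) $\sum_i l_ip_i = \sum_j m_jq_j$ and (2) the space $\mathrm{rep}_\alpha\Lambda$ of $\alpha$-dimensional representations of $\Lambda$ contains $\theta$-semi-stable representations. It is a semigroup with a finite set of semigroup generators. An element $\alpha\in\mathrm{comp}$ with $\sum_i l_ip_i=n$ corresponds to the connected component of $\mathrm{rep}_n A$ of representations $M$ with $M\downarrow_{S_1}\simeq\bigoplus_i V_i^{\oplus p_i}$ and $M\downarrow_{S_2}\simeq\bigoplus_j W_j^{\oplus q_j}$.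
   Formalization: It is assumed that every α in comp is the restriction type of some representation of A (this can fail when S is not C); loops at i are counted by the minimal dim Ext¹(X,X), since independent X, X' in one component can give fewer than 1 − χ(β_i,β_i). *)

(* Defs.v *)
From HB Require Import structures.
From mathcomp Require Import all_boot all_order all_algebra all_field.
From mathcomp Require Import all_classical all_reals all_analysis.
From mathcomp Require Import complex.

Set Implicit Arguments.
Unset Strict Implicit.
Unset Printing Implicit Defensive.

Import Order.TTheory GRing.Theory Num.Theory.
Local Open Scope classical_set_scope.
Local Open Scope ring_scope.

(* An n-dimensional representation of A is a unital algebra morphism from A to
   the n x n matrices, acting on column vectors; n = 0 is allowed. *)
Definition rep (F : fieldType) (A : algType F) (n : nat) : Type :=
  {lrmorphism A -> 'M[F]_n}.

(* Isomorphism of matrix-valued functions on an arbitrary set B: it applies to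
   representations, to their restrictions and to direct sums alike. The two
   sizes are not assumed equal; the inverse matrices g and h force n = m. *)
Definition rep_iso (F : fieldType) (B : Type) (n m : nat)
    (rho : B -> 'M[F]_n) (rho' : B -> 'M[F]_m) : Prop :=
  exists (g : 'M[F]_(m, n)) (h : 'M[F]_(n, m)),
    [/\ g *m h = 1%:M, h *m g = 1%:M &
        forall b, g *m rho b = rho' b *m g].

Definition rep_simple (F : fieldType) (A : algType F) (n : nat)
    (rho : rep A n) : Prop :=
  (0 < n)%N /\
  forall W : {vspace 'cV[F]_n},
    (forall a v, v \in W -> rho a *m v \in W) -> W = 0%VS \/ W = fullv.

(* V_0, ..., V_(s-1) is a list of all simple A-modules, one for each
   isomorphism class (for A of finite dimension). *)
Definition simple_modules (F : fieldType) (A : algType F) (s : nat)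
    (l : 'I_s -> nat) (V : forall i, rep A (l i)) : Prop :=
  [/\ forall i, rep_simple (V i),
      forall i j, rep_iso (V i) (V j) -> i = j &
      forall n (rho : rep A n), rep_simple rho -> exists i, rep_iso rho (V i)].

(* The direct sum of p_i copies of V_i, for all i. *)
Definition mult_sum (F : fieldType) (B : Type) (s : nat) (l : 'I_s -> nat)
    (V : forall i, B -> 'M[F]_(l i)) (p : 'I_s -> nat) (b : B) :=
  \mxdiag_(i < s) \mxdiag_(c < p i) V i b.

(* Semi-simplicity of the regular left module: every left ideal is a direct
   summand. *)
Definition left_ideal (F : fieldType) (A : falgType F) (I : {vspace A}) : Prop :=
  forall a x, x \in I -> a * x \in I.

Definition semisimple_algebra (F : fieldType) (A : falgType F) : Prop :=
  forall I : {vspace A}, left_ideal I ->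
  exists J : {vspace A},
    [/\ left_ideal J, (I + J)%VS = fullv & (I :&: J)%VS = 0%VS].

(* A, with its maps g1 and g2, represents the functor
   B |-> Hom_S-alg(S1, B) x Hom_S-alg(S2, B); the S-algebra structure of B is
   the common composite of S with h1 and h2. *)
Definition amalgamated_coproduct (F : fieldType) (S S1 S2 A : algType F)
    (f1 : {lrmorphism S -> S1}) (f2 : {lrmorphism S -> S2})
    (g1 : {lrmorphism S1 -> A}) (g2 : {lrmorphism S2 -> A}) : Prop :=
  (forall x, g1 (f1 x) = g2 (f2 x)) /\
  forall (B : algType F) (h1 : {lrmorphism S1 -> B}) (h2 : {lrmorphism S2 -> B}),
    (forall x, h1 (f1 x) = h2 (f2 x)) ->
    exists h : {lrmorphism A -> B},
      [/\ forall x, h (g1 x) = h1 x, forall x, h (g2 x) = h2 x &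
          forall h' : {lrmorphism A -> B},
            (forall x, h' (g1 x) = h1 x) -> (forall x, h' (g2 x) = h2 x) ->
            h' =1 h].

(* The Zariski topology on the set of closed points of rep_n A: its basic open
   sets are the non-vanishing loci of polynomials in the matrix entries. *)
Inductive rep_polyfun (F : fieldType) (A : algType F) (n : nat) :
    (rep A n -> F) -> Prop :=
| polyfun_cst c : rep_polyfun (fun=> c)
| polyfun_coord a i j : rep_polyfun (fun rho => rho a i j)
| polyfun_add f g : rep_polyfun f -> rep_polyfun g ->
    rep_polyfun (fun rho => f rho + g rho)
| polyfun_mul f g : rep_polyfun f -> rep_polyfun g ->
    rep_polyfun (fun rho => f rho * g rho).

Definition rep_basic_open (F : fieldType) (A : algType F) (n : nat)
    (U : set (rep A n)) : Prop :=
  exists2 f, rep_polyfun f & U = [set rho | f rho != 0].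

Section RepTopology.
Variables (F : fieldType) (A : algType F) (n : nat).
HB.instance Definition _ := gen_eqMixin (rep A n).
HB.instance Definition _ := gen_choiceMixin (rep A n).
HB.instance Definition _ :=
  @isSubBaseTopological.Build (rep A n) (set (rep A n)) (@rep_basic_open F A n) id.
End RepTopology.

Section DirectSum.
Variables (F : fieldType) (A : algType F).

Section Sum.
Variables (n m : nat) (rho : rep A n) (sigma : rep A m).

Definition dsum_fun (a : A) : 'M[F]_(n + m) := block_mx (rho a) 0 0 (sigma a).

Lemma dsum_fun_linear : linear dsum_fun.
Proof.
move=> c a b; rewrite /dsum_fun !linearP scale_block_mx add_block_mx.
by rewrite !scaler0 !addr0.
Qed.

Lemma dsum_fun_monoid_morphism : monoid_morphism dsum_fun.
Proof.
split; first by rewrite /dsum_fun !rmorph1 -scalar_mx_block.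
move=> a b; rewrite /dsum_fun !rmorphM /=.
rewrite -[RHS]/(block_mx _ _ _ _ *m block_mx _ _ _ _) mulmx_block.
by rewrite !mul0mx !mulmx0 !addr0 !add0r.
Qed.

HB.instance Definition _ := GRing.isLinear.Build F A _ _ dsum_fun dsum_fun_linear.
HB.instance Definition _ :=
  GRing.isMonoidMorphism.Build A _ dsum_fun dsum_fun_monoid_morphism.

Definition rep_dsum : rep A (n + m) := dsum_fun.
End Sum.

Definition zero_fun (a : A) : 'M[F]_0 := 0.

Lemma zero_fun_linear : linear zero_fun.
Proof. by move=> c a b; apply/matrixP => -[]. Qed.

Lemma zero_fun_monoid_morphism : monoid_morphism zero_fun.
Proof. by split => [|a b]; apply/matrixP => -[]. Qed.

HB.instance Definition _ := GRing.isLinear.Build F A _ _ zero_fun zero_fun_linear.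
HB.instance Definition _ :=
  GRing.isMonoidMorphism.Build A _ zero_fun zero_fun_monoid_morphism.

Definition rep_zero : rep A 0 := zero_fun.
End DirectSum.

(* A symbol beta, of size |beta|, with the subset rep_beta A of rep_|beta| A. *)
Record symbol (F : fieldType) (A : algType F) := Symbol {
  symbol_dim : nat;
  symbol_set : set (rep A symbol_dim) }.
Arguments symbol_set {F A} s.

Definition component_of (F : fieldType) (A : algType F) (n : nat)
    (rho : rep A n) : symbol A :=
  Symbol (connected_component [set: rep A n] rho).

Definition component_symbol (F : fieldType) (A : algType F) : set (symbol A) :=
  [set b | exists n (rho : rep A n), b = component_of rho].

(* The graph of the addition on component symbols induced by direct sum. *)
Definition symbol_add (F : fieldType) (A : algType F) (b b' b'' : symbol A) : Prop :=
  exists n m (rho : rep A n) (sigma : rep A m),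
    [/\ b = component_of rho, b' = component_of sigma &
        b'' = component_of (rep_dsum rho sigma)].

(* An addition is given by its graph. The zero element is the empty sum, hence
   it is never among the generators below. *)
Inductive generated (T : Type) (zero : T) (add : T -> T -> T -> Prop) (G : set T) :
    T -> Prop :=
| generated_zero : generated zero add G zero
| generated_mem x : G x -> generated zero add G x
| generated_add x y z : generated zero add G x -> generated zero add G y ->
    add x y z -> generated zero add G z.

(* G is the least generating set of D. *)
Definition semigroup_generators (T : Type) (zero : T) (add : T -> T -> T -> Prop)
    (D G : set T) : Prop :=
  [/\ G `<=` D, D `<=` generated zero add G &
      forall G', G' `<=` D -> D `<=` generated zero add G' -> G `<=` G'].

(* Extensions 0 -> X' -> E -> X -> 0. Choosing a linear splitting identifies E
   with X' (+) X, on which a acts by a block triangular matrix with corner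
   delta a; the extension splits when delta comes from a linear map h. *)
Definition ext_cocycle (F : fieldType) (A : algType F) (n n' : nat)
    (X : rep A n) (X' : rep A n') (delta : A -> 'M[F]_(n', n)) : Prop :=
  exists E : rep A (n' + n),
    forall a, E a = block_mx (X' a) (delta a) 0 (X a).

Definition ext_coboundary (F : fieldType) (A : algType F) (n n' : nat)
    (X : rep A n) (X' : rep A n') (delta : A -> 'M[F]_(n', n)) : Prop :=
  exists h : 'M[F]_(n', n), forall a, delta a = X' a *m h - h *m X a.

(* Ext^1_A(X, X') has dimension d: the classes of e_0, ..., e_(d-1) form a
   basis of cocycles modulo coboundaries. *)
Definition ext1_dim (F : fieldType) (A : algType F) (n n' : nat)
    (X : rep A n) (X' : rep A n') (d : nat) : Prop :=
  exists e : 'I_d -> A -> 'M[F]_(n', n),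
    (forall c, ext_cocycle X X' (e c)) /\
    forall delta, ext_cocycle X X' delta ->
      exists! z : 'rV[F]_d,
        ext_coboundary X X' (fun a => delta a - \sum_(c < d) z 0 c *: e c a).

Definition is_minimum (P : set nat) (d : nat) : Prop :=
  P d /\ forall d', P d' -> (d <= d')%N.

Record quiver_setting (k : nat) := QuiverSetting {
  arrows : 'I_k -> 'I_k -> nat;
  dimvec : 'I_k -> nat }.

(* Q is the quiver setting of A, with vertex i labelled by the generator b i.
   The number of arrows from i to j is the minimal dimension of Ext^1(X_i, X_j)
   over all choices of one representation X_i in each component b i. For i = j
   the two arguments are thus the same representation, so that the loops at i
   count the self-extensions of X_i; non-isomorphic arguments from the same
   component would give a smaller dimension in general. *)
Definition is_quiver_setting (F : fieldType) (A : algType F) (k : nat)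
    (b : 'I_k -> symbol A) (Q : quiver_setting k) : Prop :=
  [/\ injective b,
      semigroup_generators (component_of (rep_zero A)) (@symbol_add F A)
        (@component_symbol F A) (range b),
      forall i j, is_minimum
        [set d | exists X : forall v, rep A (symbol_dim (b v)),
                   (forall v, symbol_set (b v) (X v)) /\ ext1_dim (X i) (X j) d]
        (arrows Q i j) &
      forall i, dimvec Q i = symbol_dim (b i)].

Definition dimension_vector (s t : nat) : Type :=
  ({ffun 'I_s -> nat} * {ffun 'I_t -> nat})%type.

Definition arrow_count (r s t : nat) (a : 'I_r -> 'I_s -> nat)
    (b : 'I_r -> 'I_t -> nat) (i : 'I_s) (j : 'I_t) : nat :=
  (\sum_(k < r) a k i * b k j)%N.

Section BipartiteQuiver.
Variables (F : fieldType) (s t : nat) (n : 'I_s -> 'I_t -> nat).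

Definition bipartite_rep (alpha : dimension_vector s t) : Type :=
  forall (i : 'I_s) (j : 'I_t), 'I_(n i j) -> 'M[F]_(alpha.2 j, alpha.1 i).

Definition bipartite_subrep (alpha : dimension_vector s t)
    (phi : bipartite_rep alpha)
    (P : forall i, {vspace 'cV[F]_(alpha.1 i)})
    (Q : forall j, {vspace 'cV[F]_(alpha.2 j)}) : Prop :=
  forall i j c v, v \in P i -> phi i j c *m v \in Q j.

(* theta = (-l; m) *)
Definition theta_dot (l : 'I_s -> nat) (m : 'I_t -> nat)
    (p : 'I_s -> nat) (q : 'I_t -> nat) : int :=
  \sum_(i < s) - (l i)%:Z * (p i)%:Z + \sum_(j < t) (m j)%:Z * (q j)%:Z.

Definition semistable (l : 'I_s -> nat) (m : 'I_t -> nat)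
    (alpha : dimension_vector s t) (phi : bipartite_rep alpha) : Prop :=
  ~ exists (P : forall i, {vspace 'cV[F]_(alpha.1 i)})
           (Q : forall j, {vspace 'cV[F]_(alpha.2 j)}),
      [/\ bipartite_subrep phi P Q,
          ~ ((forall i, P i = fullv) /\ (forall j, Q j = fullv)) &
          theta_dot l m (fun i => \dim (P i)) (fun j => \dim (Q j)) < 0].

Definition comp_semigroup (l : 'I_s -> nat) (m : 'I_t -> nat) : set (dimension_vector s t) :=
  [set alpha : dimension_vector s t |
               (\sum_(i < s) l i * alpha.1 i = \sum_(j < t) m j * alpha.2 j)%N /\
               exists phi : bipartite_rep alpha, semistable l m phi].

Definition euler_form
    (x y : {ffun 'I_s -> int} * {ffun 'I_t -> int}) : int :=
  \sum_(i < s) x.1 i * y.1 i + \sum_(j < t) x.2 j * y.2 j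
  - \sum_(i < s) \sum_(j < t) (n i j)%:Z * x.1 i * y.2 j.

End BipartiteQuiver.

Definition int_vector (s t : nat) (alpha : dimension_vector s t) :
    {ffun 'I_s -> int} * {ffun 'I_t -> int} :=
  ([ffun i => (alpha.1 i)%:Z], [ffun j => (alpha.2 j)%:Z]).

(* The representations of A that restrict to (+)_i V_i^p_i on S1 and to
   (+)_j W_j^q_j on S2, as a subset of rep_d A with d = \sum_i l_i p_i. It can
   be empty even if alpha is in comp_semigroup: for S = C x C in
   S1 = S2 = M_3(C), the first idempotent having rank 2 in S1 and rank 1 in S2,
   the vector (1; 1) is in comp_semigroup, but A has no non-zero
   finite-dimensional representation. *)
Definition restriction_type (F : fieldType) (S1 S2 A : algType F)
    (g1 : {lrmorphism S1 -> A}) (g2 : {lrmorphism S2 -> A})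
    (s t : nat) (l : 'I_s -> nat) (m : 'I_t -> nat)
    (V : forall i, rep S1 (l i)) (W : forall j, rep S2 (m j))
    (alpha : dimension_vector s t) : symbol A :=
  @Symbol F A (\sum_(i < s) l i * alpha.1 i)%N
    [set M : rep A _ | rep_iso (fun x => M (g1 x)) (mult_sum (fun i => V i) alpha.1) /\
             rep_iso (fun y => M (g2 y)) (mult_sum (fun j => W j) alpha.2)].

(* Main.v *)
Require Import Defs.
From HB Require Import structures.
From mathcomp Require Import all_boot all_order all_algebra all_field.
From mathcomp Require Import all_classical all_reals all_analysis.
From mathcomp Require Import complex.

Set Implicit Arguments.
Unset Strict Implicit.
Unset Printing Implicit Defensive.

Import Order.TTheory GRing.Theory Num.Theory.
Local Open Scope classical_set_scope.
Local Open Scope ring_scope.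

(* A representation of A = S1 *_S S2 is a pair of representations of S1 and S2
   that agree on S.  Those with given multiplicities alpha form one connected
   component: the multiplicities are locally constant, being determined by traces,
   and two such representations are joined by a rational curve.  Such a
   representation yields a theta-semi-stable representation of Lambda, so the
   component symbols form the semigroup comp.  Mayer-Vietoris gives
   dim Hom_A(X, X') - dim Ext^1_A(X, X') = chi(alpha, alpha').  A representation in
   the component of a generator is simple, since a proper submodule would decompose
   the generator; by Schur's lemma dim Hom_A(X_i, X_j) is therefore delta_ij. *)

(** * Matrices and intertwiners *)

(** Only one inclusion between types and [comp] comes from semi-stability: the type of a
    representation of A lies in [comp]. That every vector of [comp] occurs as a type is
    [comp_occurs]. Occurrence also makes a symbol determine its vector, since an empty set of
    representations would not remember its type. Traces are the invariant that carries the argument.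
    Complements of left ideals yield elements acting as 1 on one simple module and as 0 on the
    others; in characteristic zero the trace of such an element gives back a multiplicity.
    Multiplicities of sums, subquotients, restrictions and connected families are therefore compared
    through traces alone, without building isomorphisms. The minimum in the definition of the arrows
    needs no semicontinuity: the Euler characteristic depends on the types only, and Hom between
    representations in generator components is the same for every choice, so Ext^1 has a constant
    dimension there. *)

(** Take a subspace inside [P] of maximal dimension: a vector of [P] outside it could be adjoined,
    giving a larger subspace inside [P]. *)
Lemma vspace_of_pred (F : fieldType) (vT : vectType F) (P : vT -> Prop) :
    P 0 -> (forall c x y, P x -> P y -> P (c *: x + y)) ->
  exists U : {vspace vT}, forall v, v \in U <-> P v.
Proof.
move=> P0 Plin.
pose Q d := `[< exists U : {vspace vT}, (forall v, v \in U -> P v) /\ \dim U = d >].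
have exQ : exists d, Q d.
  exists 0%N; apply/asboolP; exists 0%VS; split; last exact: dimv0.
  by move=> v; rewrite memv0 => /eqP->.
have bndQ d : Q d -> (d <= \dim {:vT})%N.
  by case/asboolP=> U [_ <-]; apply/dimvS/subvf.
case: (ex_maxnP exQ bndQ) => _ /asboolP[U [PU <-]] maxU.
exists U => v; split=> [|Pv]; first exact: PU.
have /maxU : Q (\dim (U + <[v]>)).
  apply/asboolP; exists (U + <[v]>)%VS; split=> // w.
  case/memv_addP=> x Ux [_ /vlineP[c ->] ->].
  by rewrite addrC; apply: Plin; [|apply: PU].
rewrite leqNgt; apply: contraNT => vU.
rewrite (ltn_leqif (dimv_leqif_eq (addvSl U <[v]>))).
apply: contra vU => /eqP->.
by rewrite -{1}[v]add0r memv_add ?mem0v ?memv_line.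
Qed.

Section ColumnVectors.
Variable F : fieldType.

Lemma mulmx_cV_inj m n (A B : 'M[F]_(m, n)) :
  (forall v : 'cV_n, A *m v = B *m v) -> A = B.
Proof.
move=> eqAB; apply/matrixP => i j.
by have /colP/(_ i) := eqAB (delta_mx j 0); rewrite -!colE !mxE.
Qed.

Lemma left_inverse_mx m n (B : 'M[F]_(n, m)) :
  (forall x : 'cV_m, B *m x = 0 -> x = 0) -> exists C, C *m B = 1%:M.
Proof.
move=> injB; have /row_freeP[C BC] : row_free B^T.
  apply: inj_row_free => v /(congr1 trmx).
  by rewrite trmx_mul trmxK trmx0 => /injB /(congr1 trmx); rewrite trmxK trmx0.
by exists C^T; rewrite -[B]trmxK -trmx_mul BC trmx1.
Qed.

Lemma two_sided_inverse m n (B : 'M[F]_(n, m)) :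
    (forall x : 'cV_m, B *m x = 0 -> x = 0) ->
    (forall y : 'cV_n, exists x, y = B *m x) ->
  exists C, C *m B = 1%:M /\ B *m C = 1%:M.
Proof.
move=> injB surjB; have [C CB] := left_inverse_mx injB; exists C; split=> //.
apply: mulmx_cV_inj => y; have [x ->] := surjB y.
by rewrite -mulmxA (mulmxA C) CB !mul1mx.
Qed.

Definition basis_mx n (W : {vspace 'cV[F]_n}) : 'M[F]_(n, \dim W) :=
  \matrix_(x, y) (vbasis W)`_y x 0.

Lemma basis_mxE n (W : {vspace 'cV[F]_n}) (z : 'cV_(\dim W)) :
  basis_mx W *m z = \sum_j z j 0 *: (vbasis W)`_j.
Proof.
apply/colP => x; rewrite !mxE summxE; apply: eq_bigr => j _.
by rewrite !mxE mulrC.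
Qed.

Lemma basis_mx_mem n (W : {vspace 'cV[F]_n}) z : basis_mx W *m z \in W.
Proof.
rewrite basis_mxE; apply: memv_suml => j _; apply: memvZ.
by apply: vbasis_mem; rewrite mem_nth ?size_tuple.
Qed.

Lemma basis_mx_surj n (W : {vspace 'cV[F]_n}) v :
  v \in W -> exists z, v = basis_mx W *m z.
Proof.
move=> Wv; exists (\col_j coord (vbasis W) j v).
rewrite basis_mxE {1}(coord_vbasis Wv).
by apply: eq_bigr => j _; rewrite mxE.
Qed.

Lemma basis_mx_inj n (W : {vspace 'cV[F]_n}) (z : 'cV_(\dim W)) : basis_mx W *m z = 0 -> z = 0.
Proof.
rewrite basis_mxE => z0; apply/colP => j; rewrite mxE.
exact: (freeP (basis_free (vbasisP W)) (fun j => z j 0)).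
Qed.

Lemma vspace_split n (W W' : {vspace 'cV[F]_n}) :
    (W + W')%VS = fullv -> (W :&: W')%VS = 0%VS ->
  exists (p : 'M[F]_((\dim W), n)) (p' : 'M[F]_((\dim W'), n)),
    let i := basis_mx W in let i' := basis_mx W' in
    [/\ p *m i = 1%:M, p' *m i' = 1%:M, p *m i' = 0, p' *m i = 0 &
        i *m p + i' *m p' = 1%:M].
Proof.
move=> WW' WiW'; pose B := row_mx (basis_mx W) (basis_mx W').
have [||C [CB BC]] := @two_sided_inverse _ _ B.
- move=> x; rewrite -[x]vsubmxK mul_row_col => /eqP; rewrite addr_eq0 => /eqP e.
  have : basis_mx W *m usubmx x \in (W :&: W')%VS.
    by rewrite memv_cap basis_mx_mem e memvN basis_mx_mem.
  rewrite WiW' memv0 => /eqP e0; rewrite (basis_mx_inj e0).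
  by move/eqP: e; rewrite e0 eq_sym oppr_eq0 => /eqP/basis_mx_inj->; rewrite col_mx0.
- move=> y; have : y \in (W + W')%VS by rewrite WW' memvf.
  case/memv_addP=> w /basis_mx_surj[z ->] [w' /basis_mx_surj[z' ->] ->].
  by exists (col_mx z z'); rewrite mul_row_col.
rewrite -[C]vsubmxK mul_col_row scalar_mx_block in CB.
rewrite -[C]vsubmxK mul_row_col in BC.
by have [ii ii' i'i i'i'] := eq_block_mx CB; exists (usubmx C), (dsubmx C).
Qed.

End ColumnVectors.

Section Intertwiners.
Variable F : fieldType.

Definition intertwines (B : Type) n n' (rho : B -> 'M[F]_n) (rho' : B -> 'M[F]_n')
    (T : 'M[F]_(n', n)) : Prop :=
  forall b, T *m rho b = rho' b *m T.

Lemma hom_space_subproof (B : Type) n n' (rho : B -> 'M[F]_n) (rho' : B -> 'M[F]_n') :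
  exists U : {vspace 'M[F]_(n', n)}, forall T, T \in U <-> intertwines rho rho' T.
Proof.
apply: vspace_of_pred => [b|c x y hx hy b]; first by rewrite mul0mx mulmx0.
by rewrite mulmxDl mulmxDr -scalemxAl -scalemxAr hx hy.
Qed.

(** Stated for functions on a bare set, so that representations of A and their restrictions to S, S1
    and S2 all give subspaces of one matrix space, which can be added and intersected. *)
Definition hom_space (B : Type) n n' (rho : B -> 'M[F]_n) (rho' : B -> 'M[F]_n') :=
  projT1 (cid (hom_space_subproof rho rho')).

Lemma hom_spaceP (B : Type) n n' (rho : B -> 'M[F]_n) (rho' : B -> 'M[F]_n') T :
  T \in hom_space rho rho' <-> intertwines rho rho' T.
Proof. by rewrite /hom_space; case: cid => U /= ->. Qed.

Lemma rep_of_fun (A : algType F) n (f : A -> 'M[F]_n) :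
  linear f -> monoid_morphism f -> exists rho : rep A n, rho =1 f.
Proof.
move=> f_lin f_mul.
pose m1 := GRing.isLinear.Build F A _ _ f f_lin.
pose m2 := GRing.isMonoidMorphism.Build A _ f f_mul.
pose rho : {lrmorphism A -> 'M[F]_n} := HB.pack f m1 m2.
by exists rho.
Qed.

(** Compression to a corner serves for subrepresentations, for quotients and for conjugates; the
    second hypothesis is multiplicativity, and each use proves it in its own way. *)
Lemma corner_rep (A : algType F) n d (rho : rep A n) (i : 'M[F]_(n, d)) p :
    p *m i = 1%:M ->
    (forall a b, p *m rho a *m i *m (p *m rho b *m i) = p *m (rho a *m rho b) *m i) ->
  exists sigma : rep A d, forall a, sigma a = p *m rho a *m i.
Proof.
move=> pi1 corner; apply: rep_of_fun => [c a b|].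
  by rewrite linearP mulmxDr mulmxDl -scalemxAr -scalemxAl.
split=> [|a b]; first by rewrite rmorph1 mulmx1.
by rewrite rmorphM /= -[RHS]/(_ *m _) corner.
Qed.

Lemma rep_iso_sym (B : Type) n m (rho : B -> 'M[F]_n) (rho' : B -> 'M[F]_m) :
  rep_iso rho rho' -> rep_iso rho' rho.
Proof.
move=> [g [h [gh hg grho]]]; exists h, g; split=> // b.
by rewrite -[h *m _]mulmx1 -gh -mulmxA [rho' b *m _]mulmxA -grho !mulmxA hg mul1mx.
Qed.

Lemma rep_iso_trans (B : Type) n m k (rho : B -> 'M[F]_n) (rho' : B -> 'M[F]_m)
    (rho'' : B -> 'M[F]_k) :
  rep_iso rho rho' -> rep_iso rho' rho'' -> rep_iso rho rho''.
Proof.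
move=> [g [h [gh hg grho]]] [g' [h' [gh' hg' grho']]].
exists (g' *m g), (h *m h'); split.
- by rewrite mulmxA -(mulmxA g') gh mulmx1.
- by rewrite mulmxA -(mulmxA h) hg' mulmx1.
- by move=> b; rewrite -mulmxA grho mulmxA grho' mulmxA.
Qed.

Lemma rep_iso_trace (B : Type) n m (rho : B -> 'M[F]_n) (rho' : B -> 'M[F]_m) b :
  rep_iso rho rho' -> \tr (rho b) = \tr (rho' b).
Proof.
move=> [g [h [gh hg grho]]].
by rewrite -[rho b]mul1mx -hg -mulmxA grho mxtrace_mulC -mulmxA gh mulmx1.
Qed.

End Intertwiners.

Section Schur.
Variables (F : fieldType) (A : algType F).

Lemma schur n m (X : rep A n) (Y : rep A m) (T : 'M[F]_(m, n)) :
    rep_simple X -> rep_simple Y -> intertwines X Y T -> T != 0 ->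
  exists C, C *m T = 1%:M /\ T *m C = 1%:M.
Proof.
move=> [n0 Xsimple] [m0 Ysimple] TX T0.
pose f := linfun (mulmx T : 'cV[F]_n -> 'cV[F]_m).
have fE v : f v = T *m v by rewrite lfunE.
have ker0 (x : 'cV_n) : T *m x = 0 -> x = 0.
  case: (Xsimple (lker f)) => [a v|k0|kf].
  - rewrite !memv_ker !fE => /eqP Tv0.
    by rewrite mulmxA TX -mulmxA Tv0 mulmx0.
  - move=> Tx0; have : x \in lker f by rewrite memv_ker fE Tx0.
    by rewrite k0 memv0 => /eqP.
  case/eqP: T0; apply: mulmx_cV_inj => v; rewrite mul0mx.
  by apply/eqP; rewrite -fE -memv_ker kf memvf.
have img (y : 'cV_m) : exists x, y = T *m x.
  case: (Ysimple (limg f)) => [a _ /memv_imgP[v _ ->]|i0|ifull].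
  - by rewrite fE mulmxA -TX -mulmxA -fE memv_img ?memvf.
  - case/eqP: T0; apply: mulmx_cV_inj => v; rewrite mul0mx.
    have : f v \in limg f by rewrite memv_img ?memvf.
    by rewrite i0 memv0 fE => /eqP.
  have : y \in limg f by rewrite ifull memvf.
  by case/memv_imgP=> x _ ->; exists x; rewrite fE.
exact: two_sided_inverse ker0 img.
Qed.

End Schur.

Lemma schur_scalar (F : closedFieldType) (A : algType F) n (X : rep A n) T :
  rep_simple X -> intertwines X X T -> exists c, T = c%:M.
Proof.
move=> Xsimple TX; have [n0 Xs] := Xsimple.
have [c] : exists c, root (char_poly T) c.
  by apply/closed_rootP; rewrite size_char_poly eqSS -lt0n.
rewrite -eigenvalue_root_char => /eigenvalueP[v vT v0]; exists c.
apply/eqP; rewrite -subr_eq0; apply: contraT => Tc0.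
have TcX : intertwines X X (T - c%:M).
  by move=> a; rewrite mulmxBl mulmxBr TX -scalar_mxC.
have [C [_ TC]] := schur Xsimple Xsimple TcX Tc0.
(* [v] is a row eigenvector, so [v *m (T - c%:M) = 0]; the right inverse of [T - c%:M] would force
   [v = 0]. *)
case/eqP: v0; rewrite -[v]mulmx1 -TC mulmxA mulmxBr vT.
by rewrite mul_mx_scalar subrr mul0mx.
Qed.

(** * Semi-simple algebras *)

Section SemisimpleAlgebra.
Variables (F : fieldType) (B : falgType F).
Hypothesis ssB : semisimple_algebra B.

(** Let W' be a maximal invariant subspace with W :&: W' = 0, and suppose that v lies outside N = W
    + W'. The left ideal I of all b with b v in N has a complement J, and J v meets N only in 0.
    Writing 1 = x + y along I and J gives y v outside N, so W' + J v contradicts maximality. *)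
Lemma invariant_complement n (rho : rep B n) (W : {vspace 'cV[F]_n}) :
    (forall b v, v \in W -> rho b *m v \in W) ->
  exists W' : {vspace 'cV[F]_n},
    [/\ forall b v, v \in W' -> rho b *m v \in W',
        (W + W')%VS = fullv & (W :&: W')%VS = 0%VS].
Proof.
move=> Winv.
pose Q d := `[< exists W' : {vspace 'cV[F]_n},
  [/\ forall b v, v \in W' -> rho b *m v \in W',
      (W :&: W')%VS = 0%VS & \dim W' = d] >].
have exQ : exists d, Q d.
  exists 0%N; apply/asboolP; exists 0%VS; split; last exact: dimv0.
  - by move=> b v; rewrite !memv0 => /eqP->; rewrite mulmx0.
  - exact: capv0.
have bndQ d : Q d -> (d <= \dim {:'cV[F]_n})%N.
  by case/asboolP=> U [_ _ <-]; apply/dimvS/subvf.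
case: (ex_maxnP exQ bndQ) => _ /asboolP[W' [W'inv WW' <-]] maxW'.
exists W'; split=> //; apply/eqP; rewrite eqEsubv subvf /=.
apply/subvP => v _; apply: contraT => vN.
set N := (W + W')%VS in vN.
have Ninv b x : x \in N -> rho b *m x \in N.
  case/memv_addP=> w Ww [w' W'w' ->].
  by rewrite mulmxDr memv_add ?Winv ?W'inv.
have [||I IP] := @vspace_of_pred _ B (fun b => rho b *m v \in N).
- by rewrite raddf0 mul0mx mem0v.
- move=> c x y xN yN; rewrite linearP mulmxDl -scalemxAl.
  by rewrite memvD ?memvZ.
have [|J [Jid IJ I0J]] := ssB (I := I).
  by move=> b x /IP xN; apply/IP; rewrite rmorphM /= -mulmxA Ninv.
have [||K KP] := @vspace_of_pred _ _ (fun w => exists2 b, b \in J & w = rho b *m v).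
- by exists 0; rewrite ?mem0v // raddf0 mul0mx.
- move=> c _ _ [x Jx ->] [y Jy ->]; exists (c *: x + y); first by rewrite memvD ?memvZ.
  by rewrite linearP mulmxDl -scalemxAl.
have NK b : b \in J -> rho b *m v \in N -> b = 0.
  by move=> Jb /IP Ib; apply/eqP; rewrite -memv0 -I0J memv_cap Ib.
have : 1 \in (I + J)%VS by rewrite IJ memvf.
case/memv_addP=> x /IP Ix [y Jy e1].
have yN : rho y *m v \notin N.
  apply: contra vN => yN; have -> : v = rho 1 *m v by rewrite rmorph1 mul1mx.
  by rewrite e1 raddfD mulmxDl memvD.
have /maxW' : Q (\dim (W' + K)).
  apply/asboolP; exists (W' + K)%VS; split=> //.
  - move=> b w /memv_addP[w1 W'w1 [w2 /KP[z Jz ->] ->]].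
    rewrite mulmxDr mulmxA memv_add ?W'inv //; apply/KP.
    by exists (b * z); [apply: Jid | rewrite rmorphM].
  apply/eqP; rewrite -subv0; apply/subvP => w.
  rewrite memv_cap => /andP[Ww /memv_addP[w1 W'w1 [w2 /KP[z Jz ->] ew]]].
  have z0 : z = 0.
    apply: NK Jz _; have -> : rho z *m v = w - w1 by rewrite ew addrC addKr.
    by rewrite memv_add ?memvN.
  by rewrite -WW' memv_cap Ww ew z0 raddf0 mul0mx addr0.
rewrite leqNgt => /negP[]; rewrite (ltn_leqif (dimv_leqif_eq (addvSl W' K))).
apply: contra yN => /eqP eW'; have : rho y *m v \in (W' + K)%VS.
  by rewrite -[rho y *m v]add0r memv_add ?mem0v //; apply/KP; exists y.
by rewrite -eW' => yW'; rewrite -[rho y *m v]add0r memv_add ?mem0v.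
Qed.

Lemma simple_orbit (A : algType F) n (V : rep A n) (v : 'cV[F]_n) :
  rep_simple V -> v != 0 -> forall w, exists b, w = V b *m v.
Proof.
move=> [n0 Vs] v0 w.
have [||U UP] := @vspace_of_pred _ _ (fun w => exists b, w = V b *m v).
- by exists 0; rewrite raddf0 mul0mx.
- move=> c _ _ [x ->] [y ->]; exists (c *: x + y).
  by rewrite linearP mulmxDl -scalemxAl.
apply/UP; case: (Vs U) => [b _ /UP[c ->]|U0|->]; last by rewrite memvf.
  by apply/UP; exists (b * c); rewrite rmorphM mulmxA.
case/eqP: v0; apply/eqP; rewrite -memv0 -U0; apply/UP.
by exists 1; rewrite rmorph1 mul1mx.
Qed.

(* With v != 0 and 1 = x + y along Ann(v) (+) L, a vector w with y w != 0 makes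
   b v |-> b y w a well-defined non-zero intertwiner. *)
Lemma simple_iso_of_ker n n' (V : rep B n) (V' : rep B n') :
    rep_simple V -> rep_simple V' -> (forall b, V' b = 0 -> V b = 0) ->
  rep_iso V V'.
Proof.
move=> Vs V's kerV; have [n0 _] := Vs.
pose v : 'cV[F]_n := delta_mx (Ordinal n0) 0.
have v0 : v != 0.
  apply/eqP => /colP/(_ (Ordinal n0)); rewrite !mxE !eqxx => /eqP.
  by rewrite oner_eq0.
have [||I IP] := @vspace_of_pred _ B (fun b => V b *m v = 0).
- by rewrite raddf0 mul0mx.
- move=> c x y x0 y0; rewrite linearP mulmxDl -scalemxAl x0 y0.
  by rewrite scaler0 addr0.
have [|L [Lid IL I0L]] := ssB (I := I).
  by move=> b x /IP x0; apply/IP; rewrite rmorphM /= -mulmxA x0 mulmx0.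
have : 1 \in (I + L)%VS by rewrite IL memvf.
case/memv_addP=> x /IP Ix [y Ly e1].
have yv : V y *m v = v.
  have : V 1 *m v = v by rewrite rmorph1 mul1mx.
  by rewrite e1 raddfD mulmxDl Ix add0r.
have by0 b : V b *m v = 0 -> b * y = 0.
  move=> bv0; apply/eqP; rewrite -memv0 -I0L memv_cap Lid // andbT.
  by apply/IP; rewrite rmorphM -mulmxA yv.
have [w yw] : exists w : 'cV_n', V' y *m w != 0.
  apply: contrapT => /forallNP yw0; case/eqP: v0; rewrite -yv kerV ?mul0mx //.
  by apply: mulmx_cV_inj => w; rewrite mul0mx; apply/eqP/contraT => /yw0.
have /boolp.choice[c cP] (j : 'I_n) : exists b, delta_mx j 0 = V b *m v.
  exact: simple_orbit.
pose T : 'M[F]_(n', n) := \matrix_(i, j) (V' (c j * y) *m w) i 0.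
have TE b : T *m (V b *m v) = V' (b * y) *m w.
  have bE : V b *m v = V (\sum_j (V b *m v) j 0 *: c j) *m v.
    rewrite {1}[V b *m v]matrix_sum_delta linear_sum mulmx_suml.
    apply: eq_bigr => j _; rewrite big_ord1 cP linearZ /= -scalemxAl.
    by [].
  have -> : b * y = (\sum_j (V b *m v) j 0 *: c j) * y.
    apply/eqP; rewrite -subr_eq0 -mulrBl; apply/eqP/by0.
    by rewrite raddfB mulmxBl -bE subrr.
  rewrite mulr_suml linear_sum mulmx_suml; apply/colP => i.
  rewrite !mxE summxE; apply: eq_bigr => j _.
  by rewrite mxE -scalerAl linearZ -scalemxAl [in RHS]mxE mulrC.
have TV : intertwines V V' T.
  move=> b; apply: mulmx_cV_inj => u.
  have [z ->] := simple_orbit Vs v0 u.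
  by rewrite -!mulmxA TE (mulmxA (V b)) -[_ *m V z]rmorphM TE -mulrA rmorphM mulmxA.
have T0 : T != 0.
  apply: contra yw => /eqP T0; have := TE 1.
  by rewrite T0 mul0mx mul1r => <-.
by have [C [CT TC]] := schur Vs V's TV T0; exists T, C.
Qed.

(** Write 1 = e + f along I = ker V' and a complementary left ideal L. Since I is two-sided, I f
    lies in both I and L, so I f = 0 and f maps V into the invariant subspace U of vectors killed by
    I. If U = 0, then f acts as 0 and e as 1 on V. If U is everything, then ker V' is contained in
    ker V, which makes V and V' isomorphic. *)
Lemma separate_pair n n' (V : rep B n) (V' : rep B n') :
    rep_simple V -> rep_simple V' -> ~ rep_iso V V' ->
  exists e, V e = 1%:M /\ V' e = 0.
Proof.
move=> Vs V's nVV'; have [_ Vsimple] := Vs.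
have [||I IP] := @vspace_of_pred _ B (fun b => V' b = 0).
- by rewrite raddf0.
- by move=> c x y x0 y0; rewrite linearP /= x0 y0 scaler0 addr0.
have [|L [Lid IL I0L]] := ssB (I := I).
  by move=> b x /IP x0; apply/IP; rewrite rmorphM /= x0 mulr0.
have : 1 \in (I + L)%VS by rewrite IL memvf.
case/memv_addP=> e Ie [f Lf e1]; exists e; split; last exact/IP.
have If0 x : x \in I -> x * f = 0.
  move=> Ix; apply/eqP; rewrite -memv0 -I0L memv_cap Lid // andbT.
  have -> : f = 1 - e by rewrite e1 addrC addKr.
  by apply/IP; move/IP: Ix => x0; rewrite rmorphM /= x0 mul0r.
have [||U UP] := @vspace_of_pred _ _ (fun w : 'cV[F]_n => forall x, x \in I -> V x *m w = 0).
- by move=> x _; rewrite mulmx0.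
- move=> c w w' w0 w'0 x Ix; rewrite mulmxDr -scalemxAr w0 // w'0 //.
  by rewrite scaler0 addr0.
have Uf (w : 'cV[F]_n) : V f *m w \in U.
  by apply/UP => x Ix; rewrite mulmxA -[_ *m V f]rmorphM If0 // raddf0 mul0mx.
have VE : V e + V f = 1%:M by rewrite -raddfD -e1; exact: rmorph1.
case: (Vsimple U) => [b w /UP w0|U0|Ufull].
- apply/UP => x Ix; rewrite mulmxA -[_ *m V b]rmorphM w0 //.
  by apply/IP; move/IP: Ix => x0; rewrite rmorphM /= x0 mul0r.
- rewrite -VE; have -> : V f = 0; last by rewrite addr0.
  apply: mulmx_cV_inj => w; rewrite mul0mx; apply/eqP; rewrite -memv0.
  by have := Uf w; rewrite U0.
case: nVV'; apply: simple_iso_of_ker => // b /IP Ib.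
apply: mulmx_cV_inj => w; rewrite mul0mx.
by have := memvf w; rewrite -Ufull => /UP; apply.
Qed.

(** A product over j != i of elements acting as 1 on V_i and as 0 on V_j. These elements do the work
    of the central idempotents of the algebra. *)
Lemma separating_elements s (l : 'I_s -> nat) (V : forall i, rep B (l i)) :
    simple_modules V ->
  forall i, exists e, forall j, V j e = (i == j)%:R%:M.
Proof.
move=> [Vs Vinj _] i.
have /boolp.choice[e eP] j : exists b, i != j -> V i b = 1%:M /\ V j b = 0.
  have [<-|ij] := eqVneq i j; first by exists 0.
  have [|b bP] := separate_pair (Vs i) (Vs j); last by exists b.
  by move=> /Vinj eij; rewrite eij eqxx in ij.
exists (\prod_(j | i != j) e j) => j; rewrite rmorph_prod.
have [<-|ij] := eqVneq i j.
  by rewrite big1 // => k ik; have [] := eP k ik.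
rewrite raddf0.
have : j \in index_enum 'I_s by rewrite mem_index_enum.
elim: (index_enum _) => //= k r IHr; rewrite inE big_cons => /predU1P[<-|jr].
  by rewrite ij (proj2 (eP j ij)) mul0r.
by case: ifP => _; rewrite IHr // mulr0.
Qed.

End SemisimpleAlgebra.

(** * Isotypic decompositions *)

Lemma mxcol_mxrow_one (F : fieldType) q (d : 'I_q -> nat) n
    (pi : forall i, 'M[F]_(d i, n)) (iota : forall i, 'M[F]_(n, d i)) :
  \mxcol_i pi i *m \mxrow_i iota i = 1%:M <->
  (forall i, pi i *m iota i = 1%:M) /\ (forall i j, i != j -> pi i *m iota j = 0).
Proof.
rewrite mul_mxcol_mxrow -mxdiagZ; split=> [e|[e1 e0]].
  split=> [i|i j ij]; move/(congr1 (fun X => submxblock X i _)): e.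
    by move/(_ i); rewrite mxblockK submxblock_diag.
  by move/(_ j); rewrite /mxdiag !mxblockK (negPf ij).
apply/eq_mxblockP => i j; have [<-{j}|ij] := eqVneq i j; last exact: e0.
by rewrite conform_mx_id.
Qed.

Section IsotypicDecomposition.
Variables (F : fieldType) (s : nat) (l : 'I_s -> nat).

Definition biorthonormal n (p : 'I_s -> nat)
    (iota : forall i, 'I_(p i) -> 'M[F]_(n, l i))
    (pi : forall i, 'I_(p i) -> 'M[F]_(l i, n)) : Prop :=
  (forall i c d, pi i c *m iota i d = (c == d)%:R%:M) /\
  (forall i j c d, i != j -> pi i c *m iota j d = 0).

Lemma biorthonormal_mxP n p (iota : forall i, 'I_(p i) -> 'M[F]_(n, l i)) pi :
  biorthonormal iota pi <->
  (\mxcol_i \mxcol_c pi i c) *m (\mxrow_i \mxrow_c iota i c) = 1%:M.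
Proof.
rewrite mxcol_mxrow_one; split=> -[e1 e0]; split.
- move=> i; apply/mxcol_mxrow_one; split=> [c|c d cd]; first by rewrite e1 eqxx.
  by rewrite e1 (negPf cd) raddf0.
- move=> i j ij; rewrite mul_mxcol_mxrow -[RHS]mxblock0.
  by apply: eq_mxblock => c d; apply: e0.
- move=> i c d; have /mxcol_mxrow_one[e1' e0'] := e1 i.
  have [<-|cd] := eqVneq c d; first exact: e1'.
  by rewrite raddf0; apply: e0'.
- move=> i j c d /e0; rewrite mul_mxcol_mxrow -[RHS]mxblock0.
  by move/eq_mxblockP.
Qed.

(** The inclusions and projections of the individual simple summands, one pair for each copy c of
    V_i; [biorthonormal] and the last clause say that they form a complete system. *)
Definition decomposition (B : Type) n (rho : B -> 'M[F]_n)
    (V : forall i, B -> 'M[F]_(l i)) (p : 'I_s -> nat)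
    (iota : forall i, 'I_(p i) -> 'M[F]_(n, l i))
    (pi : forall i, 'I_(p i) -> 'M[F]_(l i, n)) : Prop :=
  [/\ biorthonormal iota pi,
      forall i c, intertwines (V i) rho (iota i c),
      forall i c, intertwines rho (V i) (pi i c) &
      \sum_i \sum_c iota i c *m pi i c = 1%:M].

(** Cut the two inverse matrices of the isomorphism into blocks. Later arguments manipulate the
    families [iota] and [pi] and never the nested block-diagonal matrix. *)
Lemma decompositionP (B : Type) n (rho : B -> 'M[F]_n)
    (V : forall i, B -> 'M[F]_(l i)) (p : 'I_s -> nat) :
  rep_iso rho (mult_sum V p) <-> exists iota pi, @decomposition B n rho V p iota pi.
Proof.
split=> [[g [h [gh hg grho]]]|[iota [pi [orth iotaV piV total]]]].
  have hrho b : rho b *m h = h *m mult_sum V p b.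
    by rewrite -[LHS]mul1mx -hg -mulmxA (mulmxA g) grho -mulmxA gh mulmx1.
  pose iota i c := submxrow (submxrow h i) c.
  pose pi i c := submxcol (submxcol g i) c.
  have gE : g = \mxcol_i \mxcol_c pi i c.
    by rewrite -[LHS]submxcolK; apply: eq_mxcol => i; rewrite submxcolK.
  have hE : h = \mxrow_i \mxrow_c iota i c.
    by rewrite -[LHS]submxrowK; apply: eq_mxrow => i; rewrite submxrowK.
  exists iota, pi; split.
  - by apply/biorthonormal_mxP; rewrite -gE -hE.
  - move=> i c b; have := hrho b; rewrite hE /mult_sum mul_mxrow_mxdiag mul_mxrow.
    move/eq_mxrowP/(_ i); rewrite mul_mxrow_mxdiag mul_mxrow.
    by move/eq_mxrowP/(_ c).
  - move=> i c b; have := grho b; rewrite gE /mult_sum mul_mxdiag_mxcol mxcol_mul.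
    move/eq_mxcolP/(_ i); rewrite mul_mxdiag_mxcol mxcol_mul.
    by move/eq_mxcolP/(_ c).
  - move: hg; rewrite gE hE mul_mxrow_mxcol => <-.
    by apply: eq_bigr => i _; rewrite mul_mxrow_mxcol.
exists (\mxcol_i \mxcol_c pi i c), (\mxrow_i \mxrow_c iota i c); split.
- exact/biorthonormal_mxP.
- rewrite mul_mxrow_mxcol -total.
  by apply: eq_bigr => i _; rewrite mul_mxrow_mxcol.
move=> b; rewrite /mult_sum mul_mxdiag_mxcol mxcol_mul; apply: eq_mxcol => i.
by rewrite mul_mxdiag_mxcol mxcol_mul; apply: eq_mxcol => c; apply: piV.
Qed.

Lemma mult_sum_trace (B : Type) (V : forall i, B -> 'M[F]_(l i)) p b :
  \tr (mult_sum V p b) = \sum_i (\tr (V i b)) *+ p i.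
Proof.
rewrite /mult_sum mxtrace_mxdiag; apply: eq_bigr => i _.
by rewrite mxtrace_mxdiag sumr_const card_ord.
Qed.

Lemma decomposition_dsum (B : Type) n n1 n2 (rho : B -> 'M[F]_n)
    (rho1 : B -> 'M[F]_n1) (rho2 : B -> 'M[F]_n2) (V : forall i, B -> 'M[F]_(l i)) p1 p2
    (i1 : 'M[F]_(n, n1)) (q1 : 'M[F]_(n1, n)) (i2 : 'M[F]_(n, n2)) (q2 : 'M[F]_(n2, n)) :
    q1 *m i1 = 1%:M -> q2 *m i2 = 1%:M -> q1 *m i2 = 0 -> q2 *m i1 = 0 ->
    i1 *m q1 + i2 *m q2 = 1%:M ->
    intertwines rho1 rho i1 -> intertwines rho2 rho i2 ->
    intertwines rho rho1 q1 -> intertwines rho rho2 q2 ->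
    rep_iso rho1 (mult_sum V p1) -> rep_iso rho2 (mult_sum V p2) ->
  rep_iso rho (mult_sum V (fun i => p1 i + p2 i)%N).
Proof.
move=> q1i1 q2i2 q1i2 q2i1 total i1P i2P q1P q2P.
move=> /decompositionP[iota1 [pi1 [[e1 o1] iV1 pV1 t1]]].
move=> /decompositionP[iota2 [pi2 [[e2 o2] iV2 pV2 t2]]].
pose iota i (c : 'I_(p1 i + p2 i)) : 'M[F]_(n, l i) :=
  match fintype.split c with inl c => i1 *m iota1 i c | inr c => i2 *m iota2 i c end.
pose pi i (c : 'I_(p1 i + p2 i)) : 'M[F]_(l i, n) :=
  match fintype.split c with inl c => pi1 i c *m q1 | inr c => pi2 i c *m q2 end.
have mid k1 k2 k3 k4 (w : 'M[F]_(k1, k2)) (x : 'M[F]_(k2, n)) (y : 'M[F]_(n, k3))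
  (z : 'M[F]_(k3, k4)) : w *m x *m (y *m z) = w *m (x *m y) *m z by rewrite !mulmxA.
apply/decompositionP; exists iota, pi; split; first split.
- move=> i c d; rewrite /iota /pi -[in RHS](fintype.splitK c) -[in RHS](fintype.splitK d).
  case: (fintype.split c) (fintype.split d) => [c'|c'] [d'|d'] /=; rewrite mid.
  + by rewrite q1i1 mulmx1 e1 (inj_eq (@lshift_inj _ _)).
  + by rewrite q1i2 mulmx0 mul0mx eq_lrshift raddf0.
  + by rewrite q2i1 mulmx0 mul0mx eq_rlshift raddf0.
  + by rewrite q2i2 mulmx1 e2 (inj_eq (@rshift_inj _ _)).
- move=> i j c d ij; rewrite /iota /pi.
  case: (fintype.split c) (fintype.split d) => [c'|c'] [d'|d'] /=; rewrite mid.
  + by rewrite q1i1 mulmx1 o1.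
  + by rewrite q1i2 mulmx0 mul0mx.
  + by rewrite q2i1 mulmx0 mul0mx.
  + by rewrite q2i2 mulmx1 o2.
- move=> i c b; rewrite /iota.
  case: (fintype.split c) => c' /=; rewrite -mulmxA.
    by rewrite iV1 mulmxA i1P mulmxA.
  by rewrite iV2 mulmxA i2P mulmxA.
- move=> i c b; rewrite /pi.
  case: (fintype.split c) => c' /=; rewrite -mulmxA.
    by rewrite q1P mulmxA pV1 mulmxA.
  by rewrite q2P mulmxA pV2 mulmxA.
rewrite -[RHS]total -[q1]mul1mx -t1 -[q2]mul1mx -t2.
rewrite !mulmx_suml !mulmx_sumr -big_split; apply: eq_bigr => i _.
rewrite big_split_ord !mulmx_suml !mulmx_sumr; congr (_ + _).
  apply: eq_bigr => c _; rewrite /iota /pi.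
  by rewrite -[lshift _ c]/(fintype.unsplit (inl c)) fintype.unsplitK !mulmxA.
apply: eq_bigr => c _; rewrite /iota /pi.
by rewrite -[rshift _ c]/(fintype.unsplit (inr c)) fintype.unsplitK !mulmxA.
Qed.

Lemma mult_sum_delta (B : Type) (V : forall i, B -> 'M[F]_(l i)) i :
  rep_iso (V i) (mult_sum V (fun j => i == j)).
Proof.
have idx j (c : 'I_(i == j)) : i = j by case: eqP c => // _ [].
have subsingle (b : bool) (c d : 'I_b) : c = d.
  by case: b c d => [c d|[] //]; rewrite !ord1.
(* The sizes [l i] and [l k] agree only along the equality that an element of ['I_(i == k)]
   provides, so identity matrices are transported along it. *)
pose into k (e : i = k) : 'M[F]_(l i, l k) :=
  match e in _ = k return 'M[F]_(l i, l k) with erefl => 1%:M end.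
pose onto k (e : i = k) : 'M[F]_(l k, l i) :=
  match e in _ = k return 'M[F]_(l k, l i) with erefl => 1%:M end.
have onto_into k (e : i = k) : onto k e *m into k e = 1%:M.
  by case: _ / e; rewrite mulmx1.
apply/decompositionP; exists (fun j c => into j (idx j c)).
exists (fun j c => onto j (idx j c)); split; first split.
- by move=> j c d; rewrite (subsingle _ d c) eqxx onto_into.
- by move=> j k c d /eqP[]; rewrite -(idx j c) (idx k d).
- by move=> j c b; case: _ / (idx j c); rewrite mul1mx mulmx1.
- by move=> j c b; case: _ / (idx j c); rewrite mul1mx mulmx1.
rewrite (bigD1 i) //= [X in _ + X]big1 ?addr0 => [|j ij]; last first.
  by apply: big1 => c _; case/eqP: ij; rewrite (idx j c).
have c0 : 'I_(i == i) by rewrite eqxx; apply: ord0.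
rewrite (bigD1 c0) //= big1 ?addr0 => [|c]; last by rewrite (subsingle _ c c0) eqxx.
by rewrite (Prop_irrelevance (idx _ _) erefl) mulmx1.
Qed.

End IsotypicDecomposition.

(** Strong induction on the size: a representation that is not simple splits into an invariant
    subspace and an invariant complement, both smaller, and the multiplicities add up. *)
Lemma rep_iso_mult_sum (F : fieldType) (B : falgType F) s (l : 'I_s -> nat)
    (V : forall i, rep B (l i)) n (rho : rep B n) :
    semisimple_algebra B -> simple_modules V ->
  exists p, rep_iso rho (mult_sum (fun i => V i) p).
Proof.
move=> ssB [_ _ Vall]; have [k] := ubnP n; elim: k n rho => // k IHk n rho.
rewrite ltnS => nk.
have [n0|n0] := posnP n.
  move: rho {nk}; rewrite {}n0 => rho; exists (fun=> 0%N).
  apply/decompositionP; exists (fun i c => 0), (fun i c => 0).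
  split; first split; try by move=> ? [].
  - by move=> i j [].
  - by apply/matrixP => -[].
case: (pselect (rep_simple rho)) => [/Vall[i rhoV]|nsimple].
  exists (fun j => i == j); apply: rep_iso_trans rhoV _.
  exact: (mult_sum_delta (fun i => V i)).
have [W Winv [W0 Wfull]] : exists2 W : {vspace 'cV[F]_n},
    (forall b v, v \in W -> rho b *m v \in W) & W <> 0%VS /\ W <> fullv.
  apply: contrapT => nW; apply: nsimple; split=> // W Winv.
  by apply: contrapT => /not_orP W0f; apply: nW; exists W.
have [W' [W'inv WW' WIW']] := invariant_complement ssB Winv.
have [q [q' [qi q'i' qi' q'i total]]] := vspace_split WW' WIW'.
have dimW : (\dim W + \dim W' = n)%N.
  have := dimv_add_leqif W W'.
  by rewrite WIW' subvv WW' dimvf /dim /= muln1 => -[_ /eqP].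
have W0' : (0 < \dim W)%N by rewrite lt0n dimv_eq0; apply/eqP.
have W'0' : (0 < \dim W')%N.
  rewrite lt0n dimv_eq0; apply/eqP => W'0; case: Wfull.
  by rewrite -WW' W'0 addv0.
have qv v : v \in W' -> q *m v = 0.
  by case/basis_mx_surj=> z ->; rewrite mulmxA qi' mul0mx.
have q'v v : v \in W -> q' *m v = 0.
  by case/basis_mx_surj=> z ->; rewrite mulmxA q'i mul0mx.
have q'ri b : q' *m (rho b *m basis_mx W) = 0.
  apply: mulmx_cV_inj => v; rewrite mul0mx -mulmxA q'v // -mulmxA.
  by rewrite Winv ?basis_mx_mem.
have qri' b : q *m (rho b *m basis_mx W') = 0.
  apply: mulmx_cV_inj => v; rewrite mul0mx -mulmxA qv // -mulmxA.
  by rewrite W'inv ?basis_mx_mem.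
have ri b : rho b *m basis_mx W = basis_mx W *m (q *m rho b *m basis_mx W).
  by rewrite -[LHS]mul1mx -total mulmxDl -!mulmxA q'ri mulmx0 addr0.
have ri' b : rho b *m basis_mx W' = basis_mx W' *m (q' *m rho b *m basis_mx W').
  by rewrite -[LHS]mul1mx -total mulmxDl -!mulmxA qri' mulmx0 add0r.
have qr b : q *m rho b = q *m rho b *m basis_mx W *m q.
  by rewrite -[LHS]mulmx1 -total mulmxDr !mulmxA -(mulmxA q _ (basis_mx W')) qri' mul0mx addr0.
have q'r b : q' *m rho b = q' *m rho b *m basis_mx W' *m q'.
  by rewrite -[LHS]mulmx1 -total mulmxDr !mulmxA -(mulmxA q' _ (basis_mx W)) q'ri mul0mx add0r.
have [|sigma sE] := corner_rep (rho := rho) qi.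
  by move=> a b; rewrite !mulmxA -qr.
have [|sigma' s'E] := corner_rep (rho := rho) q'i'.
  by move=> a b; rewrite !mulmxA -q'r.
have [p sV] : exists p, rep_iso sigma (mult_sum (fun i => V i) p).
  apply: IHk; apply: leq_trans nk; apply: leq_trans (_ : \dim W + \dim W' <= n)%N.
    by rewrite -addn1 leq_add2l.
  by rewrite dimW.
have [p' s'V] : exists p, rep_iso sigma' (mult_sum (fun i => V i) p).
  apply: IHk; apply: leq_trans nk; apply: leq_trans (_ : \dim W + \dim W' <= n)%N.
    by rewrite -add1n leq_add2r.
  by rewrite dimW.
exists (fun i => p i + p' i)%N.
apply: (decomposition_dsum qi q'i' qi' q'i total _ _ _ _ sV s'V) => b; rewrite ?sE ?s'E.
- by rewrite -ri.
- by rewrite -ri'.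
- exact: qr.
- exact: q'r.
Qed.

Lemma intertwines_comp (F : fieldType) (B : Type) n n' n'' (rho : B -> 'M[F]_n)
    (rho' : B -> 'M[F]_n') (rho'' : B -> 'M[F]_n'') T T' :
  intertwines rho rho' T -> intertwines rho' rho'' T' -> intertwines rho rho'' (T' *m T).
Proof. by move=> TP T'P b; rewrite -mulmxA TP mulmxA T'P mulmxA. Qed.

Lemma rep_iso_dim (F : fieldType) (B : Type) n m (rho : B -> 'M[F]_n) (rho' : B -> 'M[F]_m) :
  rep_iso rho rho' -> n = m.
Proof.
move=> [g [h [gh hg _]]]; apply/eqP.
by rewrite eqn_leq (mulmx1_min gh) (mulmx1_min hg).
Qed.

Lemma mult_sum_dim s (l p : 'I_s -> nat) :
  (\sum_(i < s) \sum_(c < p i) l i = \sum_(i < s) l i * p i)%N.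
Proof. by apply: eq_bigr => i _; rewrite sum_nat_const card_ord mulnC. Qed.

(** The identity matrix of size [\sum_i l i * p i] factors through a space of dimension
    [\sum_j m j * q j], because the first family of inclusions factors through the second. *)
Lemma biorthonormal_le (F : fieldType) n s (l p : 'I_s -> nat) t (m q : 'I_t -> nat)
    (iota : forall i, 'I_(p i) -> 'M[F]_(n, l i)) pi
    (iota' : forall j, 'I_(q j) -> 'M[F]_(n, m j)) pi' :
    biorthonormal iota pi ->
    (forall i c, (\sum_j \sum_d iota' j d *m pi' j d) *m iota i c = iota i c) ->
  (\sum_(i < s) l i * p i <= \sum_(j < t) m j * q j)%N.
Proof.
move=> /biorthonormal_mxP orth fixed; rewrite -!mult_sum_dim.
set P := (X in X *m _ = _) in orth; set I := (X in _ *m X = _) in orth.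
have IE : \mxrow_j \mxrow_d iota' j d *m (\mxcol_j \mxcol_d pi' j d *m I) = I.
  rewrite mulmxA mul_mxrow_mxcol !mul_mxrow; apply: eq_mxrow => i.
  rewrite mul_mxrow; apply: eq_mxrow => c; rewrite -[RHS]fixed; congr (_ *m _).
  by apply: eq_bigr => j _; rewrite mul_mxrow_mxcol.
by move: orth; rewrite -IE mulmxA; apply: mulmx1_min.
Qed.

Lemma dim_basis_family (F : fieldType) (vT : vectType F) (I : finType) (e : I -> vT)
    (U : {vspace vT}) :
    (forall x, e x \in U) ->
    (forall u, u \in U -> exists z, u = \sum_x z x *: e x) ->
    (forall z, \sum_x z x *: e x = 0 -> forall x, z x = 0) ->
  \dim U = #|I|.
Proof.
move=> eU spanU freeU.
pose X := [tuple e (enum_val i) | i < #|I|].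
have XE (i : 'I_#|I|) : X`_i = e (enum_val i) by rewrite -tnth_nth tnth_mktuple.
have reindexE (z : I -> F) : \sum_x z x *: e x = \sum_(i < #|I|) z (enum_val i) *: X`_i.
  rewrite (reindex_onto enum_val enum_rank) /= => [|x _]; last exact: enum_rankK.
  by apply: eq_big => [i|i _]; rewrite ?enum_valK ?eqxx ?XE.
have Xfree : free X.
  apply/freeP => z z0 x; rewrite -[x]enum_valK.
  apply: (freeU (fun x => z (enum_rank x))); rewrite reindexE -[RHS]z0.
  by apply: eq_bigr => j _; rewrite enum_valK.
have /eqP -> : U == <<X>>%VS.
  rewrite eqEsubv; apply/andP; split; last first.
    by apply/span_subvP => _ /mapP[i _ ->]; apply: eU.
  apply/subvP => u /spanU[z ->]; rewrite reindexE.
  apply: memv_suml => i _; apply/memvZ/memv_span.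
  by apply: mem_nth; rewrite size_tuple.
by move: Xfree; rewrite /free size_tuple => /eqP.
Qed.

(** * Multiplicities: dimensions of Hom spaces, and recovery from traces *)

Section Multiplicities.
Variables (F : numClosedFieldType) (B : falgType F) (s : nat) (l : 'I_s -> nat).
Variable V : forall i, rep B (l i).
Hypothesis V_simples : simple_modules V.

(** The maps [iota' i d *m pi i c], from the c-th copy of V_i to the d-th copy of V_i, form a basis.
    They span because, by Schur's lemma, each corner [pi' i d *m T *m iota j c] is a scalar for i =
    j and 0 otherwise. *)
Lemma dim_hom_space n n' (rho : B -> 'M[F]_n) (rho' : B -> 'M[F]_n') p p' :
    rep_iso rho (mult_sum (fun i => V i) p) ->
    rep_iso rho' (mult_sum (fun i => V i) p') ->
  \dim (hom_space rho rho') = (\sum_(i < s) p i * p' i)%N.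
Proof.
move=> /decompositionP[iota [pi [[e1 e0] iV pV total]]].
move=> /decompositionP[iota' [pi' [[e1' e0'] iV' pV' total']]].
have [Vs Vinj _] := V_simples.
pose I := {i : 'I_s & ('I_(p i) * 'I_(p' i))%type}.
pose tg i (cd : 'I_(p i) * 'I_(p' i)) : I := Tagged _ cd.
have -> : (\sum_(i < s) p i * p' i)%N = #|{: I}|.
  rewrite card_tagged sumnE big_map big_enum /=.
  by apply: eq_bigr => i _; rewrite card_prod !card_ord.
pose e (x : I) := iota' (tag x) (tagged x).2 *m pi (tag x) (tagged x).1.
apply: (dim_basis_family (e := e)) => [x|T /hom_spaceP TP|z z0].
- by apply/hom_spaceP/(intertwines_comp (pV _ _))/iV'.
- have midV i j c d : intertwines (V j) (V i) (pi' i d *m T *m iota j c).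
    by apply: intertwines_comp (iV j c) _; apply: intertwines_comp TP (pV' i d).
  have coef i c d : exists z, pi' i d *m T *m iota i c = z%:M.
    exact: schur_scalar (Vs i) (midV i i c d).
  have coef0 i j c d : i != j -> pi' i d *m T *m iota j c = 0.
    move=> ij; apply: contraNeq ij => nz; apply/eqP/esym/Vinj.
    have [C [CT TC]] := schur (Vs j) (Vs i) (midV i j c d) nz.
    by exists (pi' i d *m T *m iota j c), C; split=> //; apply: midV.
  have /boolp.choice[z zP] (x : I) : exists z,
      pi' (tag x) (tagged x).2 *m T *m iota (tag x) (tagged x).1 = z%:M.
    exact: coef.
  exists z; rewrite -[LHS]mul1mx -total' -[LHS]mulmx1 -total.
  have -> : \sum_x z x *: e x =
      \sum_i \sum_(cd : 'I_(p i) * 'I_(p' i)) z (tg _ cd) *: e (tg _ cd).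
    rewrite (sig_big_dep (fun=> true) (fun i => xpredT)
       (fun i cd => z (tg i cd) *: e (tg i cd))).
    by apply: eq_bigr => -[i cd] _.
  rewrite mulmx_sumr; apply: eq_bigr => i _.
  have -> : \sum_cd z (tg i cd) *: e (tg i cd) =
      \sum_c \sum_d z (tg i (c, d)) *: e (tg i (c, d)).
    by rewrite pair_bigA; apply: eq_bigr => -[c d].
  rewrite mulmx_sumr; apply: eq_bigr => c _.
  rewrite !mulmx_suml (bigD1 i) //= [X in _ + X]big1 ?addr0 => [|j ji]; last first.
    rewrite !mulmx_suml big1 // => d _.
    by rewrite mulmxA -!(mulmxA (iota' j d)) coef0 // mul0mx mulmx0.
  rewrite !mulmx_suml; apply: eq_bigr => d _.
  rewrite mulmxA -!(mulmxA (iota' i d)) (zP (tg _ (c, d))) /= mul_scalar_mx.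
  by rewrite -scalemxAr.
(* Sandwiching the relation between [pi' j d] and [iota j c] isolates the coefficient of (j, c, d)
   as a scalar matrix; it has an entry to read because V_j is not zero. *)
move=> [j [c d]]; have l0 : (0 < l j)%N by have [] := Vs j.
have : pi' j d *m (\sum_x z x *: e x) *m iota j c = 0 by rewrite z0 mulmx0 mul0mx.
rewrite (bigD1 (tg _ (c, d))) //= mulmxDr mulmxDl.
rewrite [X in _ + X](_ : _ = 0) ?addr0; last first.
  rewrite mulmx_sumr mulmx_suml big1 // => -[i [c' d']] /= xy.
  rewrite -scalemxAr -scalemxAl /e /= !mulmxA -(mulmxA (pi' j d *m _)).
  have [ij|ij] := eqVneq j i; last by rewrite e0' // mul0mx scaler0.
  case: _ / ij c' d' xy => c' d'; rewrite e1 e1'.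
  rewrite -tag_eqE /tag_eq /= eqxx /= tagged_asE /= xpair_eqE negb_and.
  case/orP=> /negPf; first by move=> ->; rewrite [X in _ *m X]raddf0 mulmx0 scaler0.
  by rewrite eq_sym => ->; rewrite raddf0 mul0mx scaler0.
rewrite -scalemxAr -scalemxAl /e /= !mulmxA -(mulmxA (pi' j d *m _)) e1 e1' !eqxx mulmx1.
move/matrixP/(_ (Ordinal l0) (Ordinal l0)); rewrite !mxE eqxx mulr1n mulr1.
exact.
Qed.

Hypothesis ssB : semisimple_algebra B.

(** At the separating element of V_i the two sides become [l i * p i] and [l i * p' i];
    characteristic zero and [l i > 0] allow cancellation. *)
Lemma multiplicities_inj p p' :
    (forall b, \sum_i \tr (V i b) *+ p i = \sum_i \tr (V i b) *+ p' i) ->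
  p =1 p'.
Proof.
move=> eqtr i; have [e eP] := separating_elements ssB V_simples i.
have trE q : \sum_j \tr (V j e) *+ q j = (l i * q i)%:R.
  rewrite (bigD1 i) //= big1 ?addr0 => [|j ji]; last first.
    by rewrite eP eq_sym (negPf ji) raddf0 raddf0 mul0rn.
  by rewrite eP eqxx mxtrace_scalar mulrnA.
have := eqtr e; rewrite !trE => /eqP; rewrite eqr_nat eqn_pmul2l; first by move/eqP.
by have [Vs _ _] := V_simples; have [] := Vs i.
Qed.

Lemma multiplicities_unique n n' (rho : B -> 'M[F]_n) (rho' : B -> 'M[F]_n') p p' :
    rep_iso rho (mult_sum (fun i => V i) p) ->
    rep_iso rho' (mult_sum (fun i => V i) p') ->
    (forall b, \tr (rho b) = \tr (rho' b)) -> p =1 p'.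
Proof.
move=> rhoV rho'V eqtr; apply: multiplicities_inj => b.
have trE q : \sum_i \tr (V i b) *+ q i = \tr (mult_sum (fun i => V i) q b).
  by rewrite mult_sum_trace.
by rewrite !trE -(rep_iso_trace b rhoV) -(rep_iso_trace b rho'V).
Qed.

Lemma multiplicities_add n n1 n2 (rho : B -> 'M[F]_n) (rho1 : B -> 'M[F]_n1)
    (rho2 : B -> 'M[F]_n2) p p1 p2 :
    rep_iso rho (mult_sum (fun i => V i) p) ->
    rep_iso rho1 (mult_sum (fun i => V i) p1) ->
    rep_iso rho2 (mult_sum (fun i => V i) p2) ->
    (forall b, \tr (rho b) = \tr (rho1 b) + \tr (rho2 b)) ->
  forall i, p i = (p1 i + p2 i)%N.
Proof.
move=> rhoV rho1V rho2V eqtr; apply: multiplicities_inj => b.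
have <- : \tr (mult_sum (fun i => V i) p b) = \sum_i \tr (V i b) *+ p i.
  by rewrite mult_sum_trace.
rewrite -(rep_iso_trace b rhoV) eqtr (rep_iso_trace b rho1V).
rewrite (rep_iso_trace b rho2V) !mult_sum_trace -big_split.
by apply: eq_bigr => i _; rewrite mulrnDr.
Qed.

End Multiplicities.

(** The submodule X' of the extension E has an invariant complement. The projection P onto it along
    X' commutes with E, and the upper right block of this commutation exhibits delta as a
    coboundary. *)
Lemma semisimple_coboundary (F : fieldType) (B : falgType F) n n'
    (X : rep B n) (X' : rep B n') delta :
  semisimple_algebra B -> ext_cocycle X X' delta -> ext_coboundary X X' delta.
Proof.
move=> ssB [E EP].
pose f := linfun (mulmx (col_mx 1%:M 0 : 'M[F]_(n' + n, n')) : 'cV[F]_n' -> 'cV[F]_(n' + n)).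
have fE (v : 'cV[F]_n') : f v = col_mx v 0 by rewrite lfunE /= mul_col_mx mul1mx mul0mx.
have [|W' [W'inv WW' WIW']] := invariant_complement ssB (rho := E) (W := limg f).
  move=> b _ /memv_imgP[v _ ->]; rewrite fE EP mul_block_col !mulmx0 !addr0 mul0mx.
  by rewrite -fE memv_img ?memvf.
have [q [q' [qi q'i' qi' q'i total]]] := vspace_split WW' WIW'.
set i := basis_mx (limg f) in qi q'i total; set i' := basis_mx W' in q'i' qi' total.
have mem v : v \in limg f -> q' *m v = 0.
  by case/basis_mx_surj=> z ->; rewrite mulmxA q'i mul0mx.
have mem' v : v \in W' -> q *m v = 0.
  by case/basis_mx_surj=> z ->; rewrite mulmxA qi' mul0mx.
pose P := i' *m q'.
have PE b : E b *m P = P *m E b.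
  have Pi' : P *m i' = i' by rewrite -mulmxA q'i' mulmx1.
  have PEi : P *m (E b *m i) = 0.
    apply: mulmx_cV_inj => v; rewrite mul0mx -!mulmxA mem ?mulmx0 //.
    case/memv_imgP: (basis_mx_mem v) => w _ ->.
    rewrite fE EP mul_block_col !mulmx0 !addr0 mul0mx.
    by rewrite -fE memv_img ?memvf.
  have PEi' : P *m (E b *m i') = E b *m i'.
    apply: mulmx_cV_inj => v; rewrite -[RHS]mul1mx -total mulmxDl.
    rewrite -[i *m q *m _]mulmxA -[E b *m i' *m v]mulmxA (mem' (E b *m (i' *m v))).
      by rewrite mulmx0 add0r -!mulmxA.
    by rewrite W'inv ?basis_mx_mem.
  rewrite -[RHS]mulmx1 -total mulmxDr !mulmxA -[P *m E b *m i]mulmxA PEi mul0mx add0r.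
  by rewrite -[P *m E b *m i']mulmxA PEi'.
have Pf (v : 'cV[F]_n') : P *m col_mx v 0 = 0.
  by rewrite -mulmxA mem ?mulmx0 // -fE memv_img ?memvf.
have fP (x : 'cV[F]_(n' + n)) : exists v, x - P *m x = col_mx v 0.
  have -> : x - P *m x = i *m (q *m x).
    by rewrite -{1}[x]mul1mx -total mulmxDl mulmxA addrK.
  by case/memv_imgP: (basis_mx_mem (q *m x)) => v _ ->; exists v; rewrite fE.
(* P kills the vectors [col_mx v 0], and [x - P *m x] is always of that form; this fixes every block
   of P except the upper right one. *)
have Pl : P = block_mx 0 (ursubmx P) 0 1%:M.
  rewrite -[LHS]submxK; congr block_mx.
  - apply: mulmx_cV_inj => v; rewrite mul0mx.
    by have := Pf v; rewrite -{1}[P]submxK mul_block_col !mulmx0 !addr0 -col_mx0 => /eq_col_mx[].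
  - apply: mulmx_cV_inj => v; rewrite mul0mx.
    by have := Pf v; rewrite -{1}[P]submxK mul_block_col !mulmx0 !addr0 -col_mx0 => /eq_col_mx[].
  - apply: mulmx_cV_inj => v; rewrite mul1mx.
    have [w] := fP (col_mx 0 v); rewrite -{1}[P]submxK mul_block_col !mulmx0 !add0r.
    by rewrite opp_col_mx add_col_mx => /eq_col_mx[_ /eqP]; rewrite subr_eq0 => /eqP.
(* With p the upper right block of P, comparing these blocks in E P = P E gives X' p + delta = p X,
   whence the sign. *)
exists (- ursubmx P) => b; have := PE b; rewrite Pl EP !mulmx_block.
rewrite !(mulmx0, mul0mx, mulmx1, mul1mx, add0r, addr0) => /eq_block_mx[_ e _ _].
by rewrite block_mxKur mulmxN mulNmx opprK -e addKr.
Qed.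

(** * Representations of the coproduct *)

Section Subalgebra.
Variables (F : fieldType) (A : algType F) (P : A -> Prop).

Definition subalgebra_prop := GRing.subsemialg_closed (fun a => `[< P a >]).

(* The closure proof is an argument so that the carrier determines the algebra
   structure found by canonical inference. *)
Definition subalgebra_pred (_ : subalgebra_prop) : {pred A} := fun a => `[< P a >].

Variable closedP : subalgebra_prop.

HB.instance Definition _ :=
  GRing.isSubalgClosed.Build F A (subalgebra_pred closedP)
    closedP.

Definition subalgebra : Type := {a | a \in subalgebra_pred closedP}.

HB.instance Definition _ := [isSub for (@proj1_sig _ _ : subalgebra -> A)].
HB.instance Definition _ := [Choice of subalgebra by <:].
HB.instance Definition _ := [SubChoice_isSubAlgebra of subalgebra by <:].

End Subalgebra.

Section Coproduct.
Variables (F : fieldType) (S S1 S2 A : algType F).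
Variables (f1 : {lrmorphism S -> S1}) (f2 : {lrmorphism S -> S2}).
Variables (g1 : {lrmorphism S1 -> A}) (g2 : {lrmorphism S2 -> A}).
Hypothesis A_coprod : amalgamated_coproduct f1 f2 g1 g2.

Lemma lift_subalgebra (P : A -> Prop) (closedP : subalgebra_prop P) (B : algType F)
    (h : {lrmorphism B -> A}) :
  (forall x, P (h x)) -> exists h' : {lrmorphism B -> subalgebra closedP}, forall x, val (h' x) = h x.
Proof.
move=> Ph; have Ph' x : h x \in subalgebra_pred closedP by apply/asboolP.
pose f x : subalgebra closedP := Sub (h x) (Ph' x).
have f_lin : linear f.
  by move=> c x y; apply: val_inj; rewrite linearP !SubK linearP.
have f_mul : monoid_morphism f.
  split=> [|x y]; apply: val_inj; rewrite ?rmorph1 ?rmorphM !SubK ?rmorph1 //.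
  exact: rmorphM.
pose m1 := GRing.isLinear.Build F B _ _ f f_lin.
pose m2 := GRing.isMonoidMorphism.Build B _ f f_mul.
by exists (HB.pack_for {lrmorphism B -> subalgebra closedP} f m1 m2) => x; rewrite SubK.
Qed.

(* A retracts onto any subalgebra containing both factors, and the uniqueness
   part of the universal property makes the retraction the identity. *)
Lemma coproduct_ind (P : A -> Prop) :
    (forall x, P (g1 x)) -> (forall y, P (g2 y)) ->
    (forall c a b, P a -> P b -> P (c *: a + b)) ->
    (forall a b, P a -> P b -> P (a * b)) ->
  forall a, P a.
Proof.
move=> Pg1 Pg2 Plin Pmul a; have [g1f1 univ] := A_coprod.
have closedP : subalgebra_prop P.
  have P0 : P 0 by rewrite -(addNr (g1 0)) -scaleN1r; apply: Plin.
  split=> [||c x /asboolP Px|x y /asboolP Px /asboolP Py].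
  - by apply/asboolP; rewrite -(rmorph1 g1); apply: Pg1.
  - split=> [|x y /asboolP Px /asboolP Py]; apply/asboolP => //.
    by rewrite -[x]scale1r; apply: Plin.
  - by apply/asboolP; rewrite -[c *: x]addr0; apply: Plin.
  - by apply/asboolP/Pmul.
have [h1 h1E] := lift_subalgebra closedP Pg1.
have [h2 h2E] := lift_subalgebra closedP Pg2.
have [x|h [hg1 hg2 _]] := univ _ h1 h2.
  by apply: val_inj; rewrite h1E h2E g1f1.
have [x|id' [_ _ idP]] := univ A g1 g2; first exact: g1f1.
pose v0 (x : subalgebra closedP) : A := val x.
have v_lin : linear v0 by move=> c x y; rewrite /v0 /=.
have v_mul : monoid_morphism v0 by split.
pose m1 := GRing.isLinear.Build F (subalgebra closedP) A _ v0 v_lin.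
pose m2 := GRing.isMonoidMorphism.Build (subalgebra closedP) A v0 v_mul.
pose v := HB.pack_for {lrmorphism subalgebra closedP -> A} v0 m1 m2.
have e1 : (v \o h : {lrmorphism A -> A}) =1 id'.
  by apply: idP => x /=; rewrite ?hg1 ?hg2.
have e2 : (idfun : {lrmorphism A -> A}) =1 id' by apply: idP.
have -> : a = val (h a) by rewrite -[LHS]/(idfun a) e2 -e1.
exact/asboolP/(valP (h a)).
Qed.

(** Matrices of size 0 form the zero ring; that size is settled by [rep_zero], and the universal
    property is applied to matrices of positive size. *)
Lemma rep_coproduct n (rho1 : rep S1 n) (rho2 : rep S2 n) :
    (forall x, rho1 (f1 x) = rho2 (f2 x)) ->
  exists M : rep A n, (forall x, M (g1 x) = rho1 x) /\ (forall y, M (g2 y) = rho2 y).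
Proof.
case: n rho1 rho2 => [|n] rho1 rho2 rho12.
  by exists (rep_zero A); split=> x; apply/matrixP => -[].
have [_ univ] := A_coprod.
by have [M [Mg1 Mg2 _]] := univ 'M[F]_n.+1 rho1 rho2 rho12; exists M.
Qed.

End Coproduct.

(** * Extensions *)

Section Extensions.
Variables (F : fieldType) (A : algType F) (n n' : nat) (X : rep A n) (X' : rep A n').

Definition derivation (D : A -> 'M[F]_(n', n)) : Prop :=
  (forall c a b, D (c *: a + b) = c *: D a + D b) /\
  (forall a b, D (a * b) = X' a *m D b + D a *m X b).

(** Multiplicativity of the block triangular matrix is the Leibniz rule for its corner; [D 1 = 0],
    needed for unitality, follows from that rule at 1 * 1. *)
Lemma ext_cocycleP D : ext_cocycle X X' D <-> derivation D.
Proof.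
split=> [[E EP]|[Dlin Dmul]].
  split=> [c a b|a b].
    have : E (c *: a + b) = c *: E a + E b by rewrite linearP.
    rewrite !EP scale_block_mx add_block_mx.
    by case/eq_block_mx.
  have : E (a * b) = E a *m E b by exact: rmorphM.
  rewrite !EP mulmx_block !mulmx0 !mul0mx !addr0 !add0r.
  by case/eq_block_mx=> _ ->.
have [E EP] : exists E : rep A (n' + n), E =1 fun a => block_mx (X' a) (D a) 0 (X a).
  apply: rep_of_fun => [c a b|].
    by rewrite !linearP Dlin scale_block_mx add_block_mx scaler0 addr0.
  split=> [|a b].
    have D1 : D 1 = 0.
      have := Dmul 1 1; rewrite mulr1 !rmorph1 mul1mx mulmx1 => /eqP.
      by rewrite -subr_eq0 opprD addrA subrr sub0r oppr_eq0 => /eqP.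
    by rewrite D1 !rmorph1 -scalar_mx_block.
  rewrite -[RHS]/(_ *m _) mulmx_block !mulmx0 !mul0mx !addr0 !add0r -Dmul.
  by rewrite !rmorphM.
by exists E.
Qed.

Lemma derivation_lin D D' c :
  derivation D -> derivation D' -> derivation (fun a => c *: D a + D' a).
Proof.
move=> [Dlin Dmul] [D'lin D'mul]; split=> [d a b|a b] /=.
  rewrite Dlin D'lin !scalerDr !scalerA [c * d]mulrC -!addrA.
  by congr (_ + _); rewrite addrCA.
rewrite Dmul D'mul !mulmxDr !mulmxDl -!scalemxAr -!scalemxAl scalerDr.
by rewrite -!addrA; congr (_ + _); rewrite addrCA.
Qed.

Lemma inner_derivation h : derivation (fun a => X' a *m h - h *m X a).
Proof.
split=> [c a b|a b] /=.
  rewrite !linearP /= mulmxDl -scalemxAl scalerBr scalerN -!addrA.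
  by congr (_ + _); rewrite addrCA.
rewrite !rmorphM -![_ * _]/(_ *m _) mulmxBr mulmxBl !mulmxA addrA.
by rewrite addrNK.
Qed.

Lemma derivation_sum d (z : 'I_d -> F) (e : 'I_d -> A -> 'M[F]_(n', n)) :
  (forall c, derivation (e c)) -> derivation (fun a => \sum_c z c *: e c a).
Proof.
move=> eP; split=> [k a b|a b] /=.
  rewrite scaler_sumr -big_split; apply: eq_bigr => c _ /=.
  by have [-> _] := eP c; rewrite scalerDr !scalerA mulrC.
rewrite mulmx_sumr mulmx_suml -big_split; apply: eq_bigr => c _ /=.
by have [_ ->] := eP c; rewrite scalerDr scalemxAr scalemxAl.
Qed.

Lemma ext_coboundary_lin D D' c :
    ext_coboundary X X' D -> ext_coboundary X X' D' ->
  ext_coboundary X X' (fun a => c *: D a + D' a).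
Proof.
move=> [h hP] [h' h'P]; exists (c *: h + h') => a.
rewrite hP h'P mulmxDl mulmxDr -scalemxAl -scalemxAr scalerBr opprD !addrA.
by congr (_ - _); rewrite -!addrA; congr (_ + _); rewrite addrC.
Qed.

Lemma ext_coboundary_sum d (z : 'I_d -> F) (e : 'I_d -> A -> 'M[F]_(n', n)) :
    (forall c, ext_coboundary X X' (e c)) ->
  ext_coboundary X X' (fun a => \sum_c z c *: e c a).
Proof.
move=> /boolp.choice[h hP]; exists (\sum_c z c *: h c) => a.
rewrite mulmx_sumr mulmx_suml -sumrB; apply: eq_bigr => c _.
by rewrite hP scalerBr scalemxAr scalemxAl.
Qed.

(** P and Q express each basis of classes in the other. Uniqueness of coordinates makes the product
    of the two matrices the identity of size d', so d' is at most d. *)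
Lemma ext1_dim_le d d' : ext1_dim X X' d -> ext1_dim X X' d' -> (d' <= d)%N.
Proof.
move=> [e [eC eB]] [e' [e'C e'B]].
have /boolp.choice[P PB] c' : exists z : 'rV[F]_d,
    ext_coboundary X X' (fun a => e' c' a - \sum_(c < d) z 0 c *: e c a).
  by have [z [zB _]] := eB _ (e'C c'); exists z.
have /boolp.choice[Q QB] c : exists z : 'rV[F]_d',
    ext_coboundary X X' (fun a => e c a - \sum_(c' < d') z 0 c' *: e' c' a).
  by have [z [zB _]] := e'B _ (eC c); exists z.
apply: (@mulmx1_min _ _ _ (\matrix_(c', c) P c' 0 c) (\matrix_(c, c') Q c 0 c')).
apply/row_matrixP => c'.
have [z [_ z_uniq]] := e'B _ (e'C c').
rewrite -(z_uniq (row c' 1%:M)).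
  symmetry; apply: z_uniq.
  have := ext_coboundary_lin 1 (ext_coboundary_sum (fun c => P c' 0 c) QB) (PB c').
  move=> [h hP]; exists h => a; rewrite -hP scale1r.
  under [in RHS]eq_bigr => c _ do rewrite scalerBr.
  rewrite sumrB [RHS]addrC addrA addrNK; congr (_ - _).
  under [in RHS]eq_bigr => c _ do rewrite scaler_sumr.
  rewrite exchange_big /=; apply: eq_bigr => c _.
  rewrite !mxE scaler_suml; apply: eq_bigr => k _.
  by rewrite !mxE scalerA.
exists 0 => a; rewrite mulmx0 mul0mx subr0 (bigD1 c') //= !mxE eqxx scale1r.
rewrite big1 ?addr0 ?subrr // => c cc'.
by rewrite !mxE eq_sym (negPf cc') scale0r.
Qed.

Lemma ext1_dim_unique d d' : ext1_dim X X' d -> ext1_dim X X' d' -> d = d'.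
Proof. by move=> dP d'P; apply/eqP; rewrite eqn_leq !ext1_dim_le. Qed.

End Extensions.

(** * The Mayer-Vietoris sequence of the amalgamated coproduct *)

Section CoproductExtensions.
Variables (F : fieldType) (S : algType F) (S1 S2 : falgType F) (A : algType F).
Variables (f1 : {lrmorphism S -> S1}) (f2 : {lrmorphism S -> S2}).
Variables (g1 : {lrmorphism S1 -> A}) (g2 : {lrmorphism S2 -> A}).
Hypothesis A_coprod : amalgamated_coproduct f1 f2 g1 g2.
Hypothesis ssS1 : semisimple_algebra S1.
Hypothesis ssS2 : semisimple_algebra S2.
Variables (n n' : nat) (X : rep A n) (X' : rep A n').

(** Hom over S, S1 and S2, all inside the same matrix space. The sequence 0 -> Hom_A -> H1 (+) H2 ->
    H0 -> Ext^1_A -> 0 thus reads: Hom_A is H1 :&: H2, and Ext^1_A is H0 modulo H1 + H2. *)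
Let H0 := hom_space (fun x => X (g1 (f1 x))) (fun x => X' (g1 (f1 x))).
Let H1 := hom_space (fun x => X (g1 x)) (fun x => X' (g1 x)).
Let H2 := hom_space (fun y => X (g2 y)) (fun y => X' (g2 y)).

Lemma derivation_eq D D' :
    derivation X X' D -> derivation X X' D' ->
    (forall x, D (g1 x) = D' (g1 x)) -> (forall y, D (g2 y) = D' (g2 y)) ->
  D =1 D'.
Proof.
move=> [Dlin Dmul] [D'lin D'mul] eq1 eq2.
apply: (coproduct_ind A_coprod) => // [c a b ea eb|a b ea eb].
  by rewrite Dlin D'lin ea eb.
by rewrite Dmul D'mul ea eb.
Qed.

Lemma hom_space_coproduct : hom_space X X' = (H1 :&: H2)%VS.
Proof.
apply/vspaceP => T; apply/idP/idP; rewrite memv_cap.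
  by move/hom_spaceP=> TP; apply/andP; split; apply/hom_spaceP => x; apply: TP.
case/andP=> /hom_spaceP T1 /hom_spaceP T2; apply/hom_spaceP.
apply: (coproduct_ind A_coprod) => // [c a b ea eb|a b ea eb].
  by rewrite !linearP /= mulmxDl -scalemxAl ea eb.
by rewrite !rmorphM -![_ * _]/(_ *m _) mulmxA ea -mulmxA eb mulmxA.
Qed.

(* The class of D is the image of T under the connecting map Hom_S -> Ext^1_A
   of the Mayer-Vietoris sequence. *)
Let connecting T (D : A -> 'M[F]_(n', n)) : Prop :=
  exists h,
    (forall x, D (g1 x) = X' (g1 x) *m (T + h) - (T + h) *m X (g1 x)) /\
    (forall y, D (g2 y) = X' (g2 y) *m h - h *m X (g2 y)).

(** By semi-simplicity D is inner on S1, through some h1, and on S2, through some h2. On S both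
    describe the same derivation, so h1 - h2 is S-linear. *)
Lemma connecting_surj D : derivation X X' D -> exists2 T, T \in H0 & connecting T D.
Proof.
move=> D_der; have [Dlin Dmul] := D_der.
have [|h1 h1P] := @semisimple_coboundary _ _ _ _ (X \o g1) (X' \o g1) (D \o g1) ssS1.
  apply/ext_cocycleP; split=> [c a b|a b] /=; first by rewrite linearP Dlin.
  by rewrite rmorphM Dmul.
have [|h2 h2P] := @semisimple_coboundary _ _ _ _ (X \o g2) (X' \o g2) (D \o g2) ssS2.
  apply/ext_cocycleP; split=> [c a b|a b] /=; first by rewrite linearP Dlin.
  by rewrite rmorphM Dmul.
exists (h1 - h2); last first.
  by exists h2; split=> x; [rewrite subrK; apply: h1P | apply: h2P].
have [gf _] := A_coprod; apply/hom_spaceP => x.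
have := h2P (f2 x); rewrite /= -gf; have /= -> := h1P (f1 x).
move/eqP; rewrite subr_eq mulmxBl mulmxBr => /eqP ->.
by rewrite -[_ - _ + _]addrA [RHS]addrC addKr addrC.
Qed.

(** If k cobounds D, then T = (T + h - k) + (k - h), where the first summand is S1-linear and the
    second S2-linear. Conversely, for T = k1 + k2 the matrix k2 + h cobounds D on both factors,
    hence on A. *)
Lemma connecting_coboundary T D :
  derivation X X' D -> connecting T D -> ext_coboundary X X' D <-> T \in (H1 + H2)%VS.
Proof.
move=> D_der [h [D1 D2]]; split=> [[k kP]|/memv_addP[k1 /hom_spaceP k1P [k2 /hom_spaceP k2P eT]]].
  have -> : T = (T + h - k) + (k - h) by rewrite addrA subrK addrK.
  apply: memv_add; apply/hom_spaceP => x; rewrite mulmxBl mulmxBr.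
    have := D1 x; rewrite kP => /eqP; rewrite subr_eq => /eqP ->.
    by rewrite -[_ - _ + _]addrA opprD addrA subrr add0r opprD opprK.
  have := D2 x; rewrite kP => /eqP; rewrite subr_eq => /eqP ->.
  by rewrite -[_ - _ + _]addrA [RHS]addrC addKr addrC.
exists (k2 + h); apply: derivation_eq D_der (inner_derivation _ _ _) _ _ => x.
  rewrite D1 eT -[k1 + k2 + h]addrA mulmxDr mulmxDl [k1 *m _]k1P.
  by rewrite opprD addrACA subrr add0r.
by rewrite D2 mulmxDr mulmxDl [k2 *m _]k2P opprD addrACA subrr add0r.
Qed.

(** Glue two extensions: on S1 the one with corner X' T - T X, on S2 the direct sum. They agree on S
    since T is S-linear, and the glued representation of A stays block triangular because it is so
    on both factors. *)
Lemma connecting_exists T : T \in H0 -> exists2 D, derivation X X' D & connecting T D.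
Proof.
move/hom_spaceP=> TP.
have [gf _] := A_coprod.
pose D1 x := X' (g1 x) *m T - T *m X (g1 x).
have [rho1 rho1P] : ext_cocycle (X \o g1 : rep S1 n) (X' \o g1 : rep S1 n') D1.
  by apply/ext_cocycleP; apply: (inner_derivation (X \o g1) (X' \o g1)).
pose rho2 : rep S2 (n' + n) := rep_dsum X' X \o g2.
have [x|M [M1 M2]] := rep_coproduct A_coprod (rho1 := rho1) (rho2 := rho2).
  by rewrite rho1P /= /D1; have /= -> := TP x; rewrite subrr gf.
have /boolp.choice[D DP] : forall a, exists D, M a = block_mx (X' a) D 0 (X a).
  apply: (coproduct_ind A_coprod) => [x|y|c a b [D ea] [D' eb]|a b [D ea] [D' eb]].
  - by exists (D1 x); rewrite M1 rho1P.
  - by exists 0; rewrite M2.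
  - exists (c *: D + D'); rewrite !linearP /= ea eb.
    by rewrite scale_block_mx add_block_mx scaler0 addr0.
  exists (X' a *m D' + D *m X b); rewrite !rmorphM /= ea eb.
  by rewrite -[LHS]/(_ *m _) mulmx_block !mulmx0 !mul0mx !addr0 !add0r.
exists D; first by apply/ext_cocycleP; exists M.
exists 0; split=> x.
  have := M1 x; rewrite DP rho1P => /eq_block_mx[_ -> _ _].
  by rewrite addr0.
have := M2 x; rewrite DP => /eq_block_mx[_ -> _ _].
by rewrite mulmx0 mul0mx subrr.
Qed.

Lemma connecting_lin c T T' D D' : connecting T D -> connecting T' D' ->
  connecting (c *: T + T') (fun a => c *: D a + D' a).
Proof.
move=> [h [h1 h2]] [h' [h'1 h'2]]; exists (c *: h + h').
have -> : c *: T + T' + (c *: h + h') = c *: (T + h) + (T' + h').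
  by rewrite scalerDr addrACA.
have lin Y Y' U U' : c *: (Y' *m U - U *m Y) + (Y' *m U' - U' *m Y) =
    Y' *m (c *: U + U') - (c *: U + U') *m Y.
  by rewrite mulmxDr mulmxDl -scalemxAl -scalemxAr scalerBr opprD addrACA.
by split=> x; rewrite ?h1 ?h'1 ?h2 ?h'2 lin.
Qed.

Lemma connecting0 : connecting 0 (fun=> 0).
Proof. by exists 0; split=> x; rewrite ?addr0 mulmx0 mul0mx subrr. Qed.

Lemma connecting_sum d (z : 'I_d -> F) T D :
    (forall c, connecting (T c) (D c)) ->
  connecting (\sum_c z c *: T c) (fun a => \sum_c z c *: D c a).
Proof.
move=> TD; elim: d z T D TD => [|d IHd] z T D TD.
  rewrite big_ord0 (_ : (fun a => _) = fun=> 0); first exact: connecting0.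
  by apply/funext => a; rewrite big_ord0.
rewrite big_ord_recl (_ : (fun a => _) = fun a =>
  z ord0 *: D ord0 a + \sum_(c < d) z (lift ord0 c) *: D (lift ord0 c) a).
  by apply: connecting_lin => //; apply: IHd.
by apply/funext => a; rewrite big_ord_recl.
Qed.

(** A basis of a complement C of H1 + H2 in H0 is sent by the connecting map to a basis of classes.
    The numerical identity is the dimension formula for H1 + H2 and H1 :&: H2. *)
Lemma ext1_dim_coproduct : exists d, ext1_dim X X' d /\
  (d + \dim H1 + \dim H2 = \dim H0 + \dim (hom_space X X'))%N.
Proof.
pose C := (H0 :\: (H1 + H2))%VS.
have sub : (H1 + H2 <= H0)%VS.
  have [gf _] := A_coprod.
  rewrite subv_add; apply/andP; split; apply/subvP => T /hom_spaceP TP; apply/hom_spaceP => x //.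
  by rewrite gf TP.
have KC : (H1 + H2 + C = H0)%VS.
  by rewrite addvC addv_diff; apply/addv_idPl.
exists (\dim C); split; last first.
  rewrite hom_space_coproduct -(dimv_cap_compl H0 (H1 + H2)) (capv_idPr sub).
  by rewrite -[LHS]addnA -dimv_sum_cap addnCA addnA.
have /boolp.choice[e eP] : forall c : 'I_(\dim C), exists D,
    derivation X X' D /\ connecting (vbasis C)`_c D.
  move=> c; have [|D D_der DT] := connecting_exists (T := (vbasis C)`_c); last by exists D.
  have : (vbasis C)`_c \in C by apply: vbasis_mem; rewrite mem_nth ?size_tuple.
  by apply/subvP/diffvSl.
exists e; split=> [c|D /ext_cocycleP D_der].
  by apply/ext_cocycleP; have [] := eP c.
have [T TH DT] := connecting_surj D_der.
(* Turns the question of coordinates in Ext^1 into one in H0 modulo H1 + H2, where the component of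
   T in C answers it. *)
have residue (z : 'rV[F]_(\dim C)) :
    ext_coboundary X X' (fun a => D a - \sum_(c < \dim C) z 0 c *: e c a) <->
    T - \sum_(c < \dim C) z 0 c *: (vbasis C)`_c \in (H1 + H2)%VS.
  have e_der : derivation X X' (fun a => \sum_(c < \dim C) z 0 c *: e c a).
    by apply: derivation_sum => c; have [] := eP c.
  have e_con : connecting (\sum_(c < \dim C) z 0 c *: (vbasis C)`_c)
      (fun a => \sum_(c < \dim C) z 0 c *: e c a).
    by apply: connecting_sum => c; have [] := eP c.
  have -> : (fun a => D a - \sum_(c < \dim C) z 0 c *: e c a) =
      (fun a => -1 *: \sum_(c < \dim C) z 0 c *: e c a + D a).
    by apply/funext => a; rewrite scaleN1r addrC.
  have -> : T - \sum_(c < \dim C) z 0 c *: (vbasis C)`_c =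
      -1 *: \sum_(c < \dim C) z 0 c *: (vbasis C)`_c + T.
    by rewrite scaleN1r addrC.
  exact: connecting_coboundary (derivation_lin (-1) e_der D_der)
    (connecting_lin (-1) e_con DT).
have : T \in (H1 + H2 + C)%VS by rewrite KC.
case/memv_addP=> k Kk [w Cw eT].
exists (\row_c coord (vbasis C) c w); split.
  apply/residue; under eq_bigr => c _ do rewrite mxE.
  by rewrite -coord_vbasis // eT addrK.
move=> z /residue Kz; apply/rowP => c; rewrite mxE.
have -> : w = \sum_(c < \dim C) z 0 c *: (vbasis C)`_c.
  apply/eqP; rewrite -subr_eq0 -memv0 -(capv_diff H0 (H1 + H2)) memv_cap.
  apply/andP; split.
    rewrite memvB //; apply: memv_suml => j _; apply/memvZ/vbasis_mem.
    by rewrite mem_nth ?size_tuple.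
  have -> : w - \sum_(c < \dim C) z 0 c *: (vbasis C)`_c =
      T - \sum_(c < \dim C) z 0 c *: (vbasis C)`_c - k.
    by rewrite eT addrAC [k + w]addrC addrK.
  by rewrite memvB.
by rewrite coord_sum_free // (basis_free (vbasisP C)).
Qed.

End CoproductExtensions.

(** * The Zariski topology on representations *)

Section ZariskiTopology.
Variables (F : fieldType) (A : algType F) (n : nat).
Implicit Types (f : rep A n -> F) (rho sigma : rep A n).

(** Lets a representation be exchanged for a pointwise equal one without an equality between the two
    morphism records. *)
Lemma rep_polyfun_ext f rho sigma : rep_polyfun f -> rho =1 sigma -> f rho = f sigma.
Proof. by move=> + e; elim=> [//|a i j|? ? _ -> _ ->|? ? _ -> _ ->] //; rewrite e. Qed.

Lemma rep_polyfun_sum (I : Type) (s : seq I) (f : I -> rep A n -> F) :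
  (forall i, rep_polyfun (f i)) -> rep_polyfun (fun rho => \sum_(i <- s) f i rho).
Proof.
move=> fP; elim: s => [|i s IHs].
  rewrite (_ : (fun rho => _) = fun=> 0); first exact: polyfun_cst.
  by apply/funext => rho; rewrite big_nil.
rewrite (_ : (fun rho => _) = fun rho => f i rho + \sum_(i <- s) f i rho).
  exact: polyfun_add.
by apply/funext => rho; rewrite big_cons.
Qed.

Lemma rep_polyfun_prod (I : Type) (s : seq I) (f : I -> rep A n -> F) :
  (forall i, rep_polyfun (f i)) -> rep_polyfun (fun rho => \prod_(i <- s) f i rho).
Proof.
move=> fP; elim: s => [|i s IHs].
  rewrite (_ : (fun rho => _) = fun=> 1); first exact: polyfun_cst.
  by apply/funext => rho; rewrite big_nil.
rewrite (_ : (fun rho => _) = fun rho => f i rho * \prod_(i <- s) f i rho).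
  exact: polyfun_mul.
by apply/funext => rho; rewrite big_cons.
Qed.

Lemma rep_polyfun_trace a : rep_polyfun (fun rho : rep A n => \tr (rho a)).
Proof. by apply: rep_polyfun_sum => i; apply: polyfun_coord. Qed.

Lemma basic_open_open (f : rep A n -> F) : rep_polyfun f -> open [set rho | f rho != 0].
Proof.
move=> fP; exists [set [set rho | f rho != 0]]; last by rewrite bigcup_set1.
by move=> _ ->; apply: (@finI_from1 _ _ _ id); exists f.
Qed.

(** The non-vanishing loci are declared as a subbase only; they form a base since a finite
    intersection of them is the non-vanishing locus of the product. *)
Lemma open_basic (O : set (rep A n)) rho : open O -> O rho ->
  exists f, [/\ rep_polyfun f, f rho != 0 & forall sigma, f sigma != 0 -> O sigma].
Proof.
move=> [D' D'fin <-] [U D'U Urho]; have [D DU UE] := D'fin _ D'U.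
have [f [fP fE]] : exists f, rep_polyfun f /\
    forall sigma, f sigma != 0 <-> forall W, W \in finmap.enum_fset D -> W sigma.
  have : forall W, W \in finmap.enum_fset D -> rep_basic_open W.
    by move=> W WD; have := DU W WD; rewrite inE.
  elim: (finmap.enum_fset D) => [_|W s IHs Ws].
    by exists (fun=> 1); split; [apply: polyfun_cst | rewrite oner_neq0].
  have [|f [fP fE]] := IHs; first by move=> Z Zs; apply: Ws; rewrite inE Zs orbT.
  have [g gP WE] : rep_basic_open W by apply: Ws; rewrite inE eqxx.
  exists (fun sigma => g sigma * f sigma); split; first exact: polyfun_mul.
  move=> sigma; rewrite mulf_eq0 negb_or; split=> [/andP[gs fs] Z|Zs].
    by rewrite inE => /predU1P[->|]; [rewrite WE | move: Z; apply/fE].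
  apply/andP; split; first by have := Zs W; rewrite inE eqxx WE; apply.
  by apply/fE => Z Zin; apply: Zs; rewrite inE Zin orbT.
exists f; split=> // [|sigma /fE fs]; last first.
  have Usigma : (U : set (rep A n)) sigma by rewrite -UE => W WD; apply: fs.
  by exists U.
have Ur : (U : set (rep A n)) rho := Urho.
by apply/fE => W WD; move: Ur; rewrite -UE; apply.
Qed.

(** A polynomial function with finitely many values has open and closed fibres: the fibre over f rho
    is where the product of the f - c, over the other values c, does not vanish, and its complement
    is where f - f rho does not vanish. *)
Lemma rep_polyfun_connected f (vals : seq F) (B : set (rep A n)) rho sigma :
    rep_polyfun f -> (forall tau, f tau \in vals) -> connected B ->
  B rho -> B sigma -> f rho = f sigma.
Proof.
move=> fP fvals Bconn Brho Bsigma; pose C := [set tau | f tau = f rho].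
suff BC : B `&` C = B by have [] : (B `&` C) sigma by rewrite BC.
have diffP c : rep_polyfun (fun tau => f tau - c).
  by apply: polyfun_add => //; apply: polyfun_cst.
apply: Bconn; first by exists rho.
  exists C => //.
  rewrite (_ : C = [set tau | \prod_(c <- vals | c != f rho) (f tau - c) != 0]).
    apply: basic_open_open; rewrite (_ : (fun tau => _) = fun tau =>
      \prod_(c <- [seq c <- vals | c != f rho]) (f tau - c)).
      exact: rep_polyfun_prod.
    by apply/funext => tau; rewrite big_filter.
  apply/seteqP; split=> tau /=; rewrite -big_filter prodf_seq_neq0.
    by move=> ->; apply/allP => c; rewrite mem_filter subr_eq0 eq_sym => /andP[].
  move/allP=> nz; apply: contrapT => /eqP neq.
  by have := nz (f tau); rewrite mem_filter neq fvals subrr eqxx => /(_ isT).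
exists C => //; rewrite -(setCK C); apply: open_closedC.
rewrite (_ : ~` C = [set tau | f tau - f rho != 0]); first exact: basic_open_open.
by apply/seteqP; split=> tau /=; rewrite subr_eq0 => /eqP.
Qed.

End ZariskiTopology.

(** * Rational functions of one parameter with poles in the zeros of D *)

Section RationalFunctions.
Variables (F : numFieldType) (D : {poly F}).

(** Functions represented by elements of F[t][1/D]. The values of [phi] at the zeros of D are
    arbitrary, so an inverse matrix may take any default value there. *)
Definition rational_off (phi : F -> F) : Prop :=
  exists (p : {poly F}) k, forall t, D.[t] != 0 -> phi t * D.[t] ^+ k = p.[t].

Lemma rational_cst c : rational_off (fun=> c).
Proof. by exists c%:P, 0%N => t _; rewrite hornerC mulr1. Qed.

Lemma rational_add phi psi :
  rational_off phi -> rational_off psi -> rational_off (fun t => phi t + psi t).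
Proof.
move=> [p [k pk]] [q [m qm]]; exists (p * D ^+ m + q * D ^+ k), (k + m)%N => t Dt.
rewrite hornerD !hornerM !horner_exp -pk // -qm // exprD mulrDl.
by rewrite !mulrA [psi t * _ * _]mulrAC.
Qed.

Lemma rational_mul phi psi :
  rational_off phi -> rational_off psi -> rational_off (fun t => phi t * psi t).
Proof.
move=> [p [k pk]] [q [m qm]]; exists (p * q), (k + m)%N => t Dt.
by rewrite hornerM -pk // -qm // exprD mulrACA.
Qed.

Lemma rational_sum (I : Type) (s : seq I) (phi : I -> F -> F) :
  (forall i, rational_off (phi i)) -> rational_off (fun t => \sum_(i <- s) phi i t).
Proof.
move=> phiP; elim: s => [|i s IHs].
  rewrite (_ : (fun t => _) = fun=> 0); first exact: rational_cst.
  by apply/funext => t; rewrite big_nil.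
rewrite (_ : (fun t => _) = fun t => phi i t + \sum_(i <- s) phi i t).
  exact: rational_add.
by apply/funext => t; rewrite big_cons.
Qed.

Lemma nonroot (p : {poly F}) : p != 0 -> exists t, p.[t] != 0.
Proof.
move=> p0; apply: contrapT => /forallNP pt.
have [] : (size [seq (i%:R : F) | i <- iota 0 (size p)] < size p)%N -> False.
  by rewrite size_map size_iota ltnn.
apply: max_poly_roots => //.
  by apply/allP => t _; apply/rootP/eqP/contraT => /pt.
by rewrite map_inj_uniq ?iota_uniq // => i j /eqP; rewrite eqr_nat => /eqP.
Qed.

Definition rational_mx m n (N : F -> 'M[F]_(m, n)) : Prop :=
  forall i j, rational_off (fun t => N t i j).

Lemma rational_mx_cst m n (N : 'M[F]_(m, n)) : rational_mx (fun=> N).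
Proof. by move=> i j; apply: rational_cst. Qed.

Lemma rational_mx_mul m n k (N : F -> 'M[F]_(m, n)) (N' : F -> 'M[F]_(n, k)) :
  rational_mx N -> rational_mx N' -> rational_mx (fun t => N t *m N' t).
Proof.
move=> Nr N'r i j; rewrite (_ : (fun t => _) = fun t => \sum_l N t i l * N' t l j).
  by apply: rational_sum => l; apply: rational_mul.
by apply/funext => t; rewrite mxE.
Qed.

Definition eval_mx n t (G : 'M[{poly F}]_n) : 'M[F]_n := map_mx (horner_eval t) G.

Lemma det_eval_mx n t (G : 'M[{poly F}]_n) : \det (eval_mx t G) = (\det G).[t].
Proof. by rewrite /eval_mx det_map_mx. Qed.

Lemma rational_eval_mx n (G : 'M[{poly F}]_n) : rational_mx (fun t => eval_mx t G).
Proof. by move=> i j; exists (G i j), 0%N => t _; rewrite mulr1 mxE. Qed.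

(** Cramer's rule. The factor E allows one denominator D to serve several matrices at once. *)
Lemma rational_invmx n (G : 'M[{poly F}]_n) (E : {poly F}) :
  D = \det G * E -> rational_mx (fun t => invmx (eval_mx t G)).
Proof.
move=> DE i j; exists ((\adj G) i j * E), 1%N => t.
rewrite DE !hornerM mulf_eq0 negb_or -det_eval_mx => /andP[Gt _].
rewrite /invmx unitmxE unitfE Gt mxE expr1 mulrA; congr (_ * _).
by rewrite mulrAC mulVf // mul1r /eval_mx -map_mx_adj mxE.
Qed.

End RationalFunctions.

Lemma conjugate_rep (F : fieldType) (B : algType F) n (rho : rep B n) (g h : 'M[F]_n) :
    g *m h = 1%:M -> h *m g = 1%:M ->
  exists sigma : rep B n, forall b, sigma b = g *m rho b *m h.
Proof.
move=> gh hg; apply: corner_rep => // a b.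
by rewrite !mulmxA -(mulmxA _ h g) hg mulmx1.
Qed.

Lemma rational_mx_ext (F : numFieldType) (D : {poly F}) m n (N N' : F -> 'M[F]_(m, n)) :
  (forall t, D.[t] != 0 -> N t = N' t) -> rational_mx D N' -> rational_mx D N.
Proof.
by move=> NN' N'r i j; have [p [k pE]] := N'r i j; exists p, k => t Dt; rewrite NN' ?pE.
Qed.

Section Deformation.
Variables (F : numFieldType) (S S1 S2 A : algType F).
Variables (f1 : {lrmorphism S -> S1}) (f2 : {lrmorphism S -> S2}).
Variables (g1 : {lrmorphism S1 -> A}) (g2 : {lrmorphism S2 -> A}).
Hypothesis A_coprod : amalgamated_coproduct f1 f2 g1 g2.
Variables (n : nat).

Lemma rep_coproduct_ext (rho sigma : rep A n) :
    (forall x, rho (g1 x) = sigma (g1 x)) -> (forall y, rho (g2 y) = sigma (g2 y)) ->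
  rho =1 sigma.
Proof.
move=> e1 e2; apply: (coproduct_ind A_coprod) => // [c a b ea eb|a b ea eb].
  by rewrite !linearP /= ea eb.
by rewrite !rmorphM /= ea eb.
Qed.

(** The curve is irreducible: a non-empty basic open subset contains M t for all t off the zeros of
    D and of a non-zero numerator. Two such subsets meet, since the product of D and the two
    numerators has a non-root. *)
Lemma rational_curve_connected (D : {poly F}) (M : F -> rep A n) :
    D != 0 -> (forall a, rational_mx D (fun t => M t a)) ->
  connected [set rho : rep A n | exists2 t, D.[t] != 0 & rho =1 M t].
Proof.
move=> D0 Mrat; set P := [set _ | _].
have polyfun_rat f : rep_polyfun f -> rational_off D (fun t => f (M t)).
  elim=> [c|a i j|? ? _ r1 _ r2|? ? _ r1 _ r2].
  - exact: rational_cst.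
  - exact: Mrat.
  - exact: rational_add.
  - exact: rational_mul.
have numerator f rho : rep_polyfun f -> P rho -> f rho != 0 ->
    exists2 p : {poly F}, p != 0 & forall t, D.[t] != 0 -> p.[t] != 0 -> f (M t) != 0.
  move=> fP [t Dt rhoM] frho; have [p [k pE]] := polyfun_rat f fP; exists p.
    apply: contraNneq frho => p0; have := pE t Dt; rewrite p0 horner0 => /eqP.
    by rewrite mulf_eq0 expf_eq0 (negPf Dt) andbF orbF (rep_polyfun_ext fP rhoM).
  move=> t' Dt'; rewrite -pE //; by apply: contraNneq => ->; rewrite mul0r.
move=> B [rho Brho] [C Copen BC] [C' C'closed BC'].
apply/seteqP; split=> [tau|tau Ptau]; first by rewrite BC => -[].
apply: contrapT => nB.
have [Prho Crho] : (P `&` C) rho by rewrite -BC.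
have nC' : (~` C') tau by move=> C'tau; apply: nB; rewrite BC'.
have [f [fP frho fC]] := open_basic Copen Crho.
have [f' [f'P f'tau f'C']] := open_basic (closed_openC C'closed) nC'.
have [p p0 pE] := numerator f rho fP Prho frho.
have [p' p'0 p'E] := numerator f' tau f'P Ptau f'tau.
have [t] : exists t, (D * (p * p')).[t] != 0 by apply: nonroot; rewrite !mulf_neq0.
rewrite !hornerM !mulf_eq0 !negb_or => /and3P[Dt pt p't].
have PM : P (M t) by exists t.
have : B (M t) by rewrite BC; split=> //; apply/fC/pE.
by rewrite BC' => -[_]; apply/f'C'/p'E.
Qed.

(* The two conjugating matrices g and h are joined to 1 along lines: with
   c = h^-1 g, which centralizes the image of S, the factors are conjugated by
   G_t = 1 + t (g - 1) and by G_t C_t^-1 with C_t = 1 + t (c - 1). *)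
Lemma component_of_iso (rho sigma : rep A n) :
    rep_iso (fun x => rho (g1 x)) (fun x => sigma (g1 x)) ->
    rep_iso (fun y => rho (g2 y)) (fun y => sigma (g2 y)) ->
  connected_component [set: rep A n] rho sigma.
Proof.
move=> [g [g' [gg' g'g gP]]] [h [h' [hh' h'h hP]]].
have [gf _] := A_coprod.
pose c := h' *m g.
have cK : g' *m h *m c = 1%:M by rewrite /c -mulmxA (mulmxA h) hh' mul1mx.
have h'P y : h' *m sigma (g2 y) = rho (g2 y) *m h'.
  by rewrite -[LHS]mulmx1 -hh' -mulmxA (mulmxA (sigma _)) -hP !mulmxA h'h mul1mx.
have cP x : c *m rho (g1 (f1 x)) = rho (g1 (f1 x)) *m c.
  by rewrite -mulmxA gP mulmxA !gf h'P mulmxA.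
pose line (w : 'M[F]_n) : 'M[{poly F}]_n := 1%:M + 'X *: map_mx polyC (w - 1%:M).
have lineE t w : eval_mx t (line w) = 1%:M + t *: (w - 1%:M).
  apply/matrixP => i j; rewrite !mxE /horner_eval hornerD hornerM hornerX hornerC.
  by rewrite -polyC_natr hornerC.
have line0 w : eval_mx 0 (line w) = 1%:M by rewrite lineE scale0r addr0.
have line1 w : eval_mx 1 (line w) = w by rewrite lineE scale1r addrC subrK.
have [gU _] := mulmx1_unit gg'; have [hU h'U] := mulmx1_unit hh'.
have cU : c \in unitmx by rewrite unitmx_mul h'U.
pose D := \det (line g) * \det (line c).
have DE t : (D.[t] != 0) = (eval_mx t (line g) \in unitmx) && (eval_mx t (line c) \in unitmx).
  by rewrite hornerM mulf_eq0 negb_or -!det_eval_mx !unitmxE !unitfE.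
have D0t : D.[0] != 0 by rewrite DE !line0 !unitmx1.
have D1t : D.[1] != 0 by rewrite DE !line1 gU.
pose G t := eval_mx t (line g); pose G' t := invmx (G t).
pose C t := eval_mx t (line c); pose C' t := invmx (C t).
(* Where D vanishes, G_t or C_t is singular; M t is then the placeholder [rho], and the curve leaves
   such t out. *)
have /boolp.choice[M MP] t : exists Mt : rep A n, D.[t] != 0 ->
    (forall x, Mt (g1 x) = G t *m rho (g1 x) *m G' t) /\
    (forall y, Mt (g2 y) = G t *m C' t *m rho (g2 y) *m (C t *m G' t)).
  have [_|] := eqVneq D.[t] 0; first by exists rho.
  rewrite DE => /andP[Gu Cu].
  have [||rho1 rho1E] := conjugate_rep (rho \o g1) (g := G t) (h := G' t).
  - exact: mulmxV.
  - exact: mulVmx.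
  have [||rho2 rho2E] := conjugate_rep (rho \o g2) (g := G t *m C' t) (h := C t *m G' t).
  - by rewrite mulmxA -(mulmxA (G t)) mulVmx // mulmx1 mulmxV.
  - by rewrite mulmxA -(mulmxA (C t)) mulVmx // mulmx1 mulmxV.
  have [x|Mt [Mt1 Mt2]] := rep_coproduct A_coprod (rho1 := rho1) (rho2 := rho2).
    have Cc : C t *m rho (g1 (f1 x)) = rho (g1 (f1 x)) *m C t.
      rewrite /C lineE mulmxDl mulmxDr mul1mx mulmx1 -scalemxAl -scalemxAr.
      by rewrite mulmxBl mulmxBr mul1mx mulmx1 cP.
    rewrite rho1E rho2E /= -gf !mulmxA -(mulmxA (G t *m C' t)) -Cc !mulmxA.
    by rewrite -(mulmxA (G t) (C' t)) mulVmx // mulmx1.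
  by exists Mt => _; split=> x; rewrite ?Mt1 ?Mt2 ?rho1E ?rho2E.
have Gr : rational_mx D G by apply: rational_eval_mx.
have Cr : rational_mx D C by apply: rational_eval_mx.
have G'r : rational_mx D G' by apply: (rational_invmx (E := \det (line c))).
have C'r : rational_mx D C' by apply: (rational_invmx (E := \det (line g))); rewrite mulrC.
have Mrat : forall a, rational_mx D (fun t => M t a).
  apply: (coproduct_ind A_coprod) => [x|y|k a b ra rb|a b ra rb].
  - apply: (rational_mx_ext (N' := fun t => G t *m rho (g1 x) *m G' t)) => [t Dt|].
      by have [-> _] := MP t Dt.
    apply: rational_mx_mul => //; apply: rational_mx_mul => //.
    exact: rational_mx_cst.
  - apply: (rational_mx_ext (N' := fun t =>
       G t *m C' t *m rho (g2 y) *m (C t *m G' t))) => [t Dt|].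
      by have [_ ->] := MP t Dt.
    apply: rational_mx_mul; last exact: rational_mx_mul.
    apply: rational_mx_mul; last exact: rational_mx_cst.
    exact: rational_mx_mul.
  - apply: (rational_mx_ext (N' := fun t => k%:M *m M t a + M t b)) => [t _|i j].
      by rewrite linearP mul_scalar_mx.
    rewrite (_ : (fun t => _) = fun t => (k%:M *m M t a) i j + M t b i j).
      apply: rational_add => //; apply: rational_mx_mul => //.
      exact: rational_mx_cst.
    by apply/funext => t; rewrite mxE.
  apply: (rational_mx_ext (N' := fun t => M t a *m M t b)) => [t _|].
    by rewrite rmorphM.
  exact: rational_mx_mul.
have D0 : D != 0 by apply: contraNneq D0t => ->; rewrite horner0.
apply: (connected_component_max _ _ (rational_curve_connected D0 Mrat)) => //.
  exists 0 => //; have [M1 M2] := MP 0 D0t; apply: rep_coproduct_ext => x.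
    by rewrite M1 /G' /G line0 invmx1 mul1mx mulmx1.
  by rewrite M2 /G' /C' /G /C !line0 invmx1 !mul1mx mulmx1.
exists 1 => //; have [M1 M2] := MP 1 D1t; apply: rep_coproduct_ext => x.
  by rewrite M1 /G' /G line1 gP mulmxK.
(* At t = 1 the second conjugating matrix G_t C_t^-1 is g c^-1 = h, so the curve ends at [sigma]. *)
have gc : g *m invmx c = h by rewrite -[RHS](mulmxK cU) [h *m c]mulmxA hh' mul1mx.
have cg : c *m invmx g = h' by rewrite mulmxK.
by rewrite M2 /G' /C' /G /C !line1 gc cg hP -mulmxA hh' mulmx1.
Qed.

End Deformation.

(** * Restriction types *)

(** Recombines the copies of each V_i. In the application the columns of [E i] are a basis of a
    subspace of the multiplicity space and [L i] is a left inverse of it. *)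
Lemma biorthonormal_sub (F : fieldType) n s (l p d : 'I_s -> nat)
    (iota : forall i, 'I_(p i) -> 'M[F]_(n, l i)) pi
    (E : forall i, 'M[F]_(p i, d i)) (L : forall i, 'M[F]_(d i, p i)) :
    biorthonormal iota pi -> (forall i, L i *m E i = 1%:M) ->
  biorthonormal (fun i (c : 'I_(d i)) => \sum_x E i x c *: iota i x)
                (fun i c => \sum_x L i c x *: pi i x).
Proof.
move=> [e1 e0] LE; split=> [i c c'|i j c c' ij]; rewrite mulmx_suml; last first.
  rewrite big1 // => x _; rewrite mulmx_sumr big1 // => y _.
  by rewrite -scalemxAl -scalemxAr e0 // !scaler0.
have /matrixP/(_ c c') := LE i; rewrite mxE [RHS]mxE => <-.
rewrite raddf_sum; apply: eq_bigr => x _; rewrite mulmx_sumr (bigD1 x) //= big1 ?addr0.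
  by rewrite -scalemxAl -scalemxAr e1 eqxx scalerA scale_scalar_mx mulr1.
move=> y yx; rewrite -scalemxAl -scalemxAr e1 eq_sym (negPf yx).
by rewrite raddf0 !scaler0.
Qed.

Lemma vbasis_coords (F : fieldType) (vT : vectType F) (U : {vspace vT}) N u :
  \dim U = N -> u \in U -> exists z : 'I_N -> F, u = \sum_k z k *: (vbasis U)`_k.
Proof. by move=> <- Uu; exists (fun k => coord (vbasis U) k u); apply: coord_vbasis. Qed.

Lemma theta_dot_ge0 s t (l : 'I_s -> nat) (m : 'I_t -> nat) p q :
  (0 <= theta_dot l m p q) = (\sum_(i < s) l i * p i <= \sum_(j < t) m j * q j)%N.
Proof.
rewrite /theta_dot (_ : \sum_(i < s) _ = - (\sum_(i < s) l i * p i)%N%:Z); last first.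
  by rewrite -natz natr_sum -sumrN; apply: eq_bigr => i _; rewrite natz PoszM mulNr.
rewrite (_ : \sum_(j < t) _ = (\sum_(j < t) m j * q j)%N%:Z); last first.
  by rewrite -natz natr_sum; apply: eq_bigr => j _; rewrite natz PoszM.
by rewrite addrC subr_ge0 lez_nat.
Qed.

Section RestrictionTypes.
Variables (F : numClosedFieldType) (S S1 S2 : falgType F) (A : algType F).
Variables (f1 : {lrmorphism S -> S1}) (f2 : {lrmorphism S -> S2}).
Variables (g1 : {lrmorphism S1 -> A}) (g2 : {lrmorphism S2 -> A}).
Hypothesis ssS : semisimple_algebra S.
Hypothesis ssS1 : semisimple_algebra S1.
Hypothesis ssS2 : semisimple_algebra S2.
Hypothesis A_coprod : amalgamated_coproduct f1 f2 g1 g2.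
Variables (r s t : nat) (u : 'I_r -> nat) (U : forall k, rep S (u k)).
Variables (l : 'I_s -> nat) (V : forall i, rep S1 (l i)).
Variables (m : 'I_t -> nat) (W : forall j, rep S2 (m j)).
Hypotheses (U_simples : simple_modules U) (V_simples : simple_modules V).
Hypothesis W_simples : simple_modules W.
Variables (a : 'I_r -> 'I_s -> nat) (b : 'I_r -> 'I_t -> nat).
Hypothesis V_res : forall i,
  rep_iso (fun x => V i (f1 x)) (mult_sum (fun k => U k) (fun k => a k i)).
Hypothesis W_res : forall j,
  rep_iso (fun x => W j (f2 x)) (mult_sum (fun k => U k) (fun k => b k j)).

(** The condition of [restriction_type] for a representation of any size n, so that the type of a
    direct sum or of a subquotient can be discussed before n is rewritten as a sum over alpha. *)
Definition has_type n (M : rep A n) (alpha : dimension_vector s t) : Prop :=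
  rep_iso (fun x => M (g1 x)) (mult_sum (fun i => V i) alpha.1) /\
  rep_iso (fun y => M (g2 y)) (mult_sum (fun j => W j) alpha.2).

Lemma has_type_exists n (M : rep A n) : exists alpha, has_type M alpha.
Proof.
have [p Mp] := rep_iso_mult_sum (M \o g1) ssS1 V_simples.
have [q Mq] := rep_iso_mult_sum (M \o g2) ssS2 W_simples.
exists ([ffun i => p i], [ffun j => q j]); split.
  by rewrite (_ : fun_of_fin _ = p) //; apply/funext => i; rewrite ffunE.
by rewrite (_ : fun_of_fin _ = q) //; apply/funext => j; rewrite ffunE.
Qed.

Lemma has_type_dim n (M : rep A n) alpha : has_type M alpha ->
  n = (\sum_(i < s) l i * alpha.1 i)%N /\ n = (\sum_(j < t) m j * alpha.2 j)%N.
Proof. by move=> [/rep_iso_dim e1 /rep_iso_dim e2]; rewrite -!mult_sum_dim. Qed.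

Lemma has_type_unique n n' (M : rep A n) (M' : rep A n') alpha alpha' :
    has_type M alpha -> has_type M' alpha' ->
    (forall x, \tr (M (g1 x)) = \tr (M' (g1 x))) ->
    (forall y, \tr (M (g2 y)) = \tr (M' (g2 y))) ->
  alpha = alpha'.
Proof.
move: alpha alpha' => [p q] [p' q'] [M1 M2] [M'1 M'2] tr1 tr2; congr pair.
  apply/ffunP; exact: (multiplicities_unique V_simples ssS1 M1 M'1 tr1).
apply/ffunP; exact: (multiplicities_unique W_simples ssS2 M2 M'2 tr2).
Qed.

Lemma has_type_add n n1 n2 (M : rep A n) (M1 : rep A n1) (M2 : rep A n2) alpha alpha1 alpha2 :
    has_type M alpha -> has_type M1 alpha1 -> has_type M2 alpha2 ->
    (forall x, \tr (M x) = \tr (M1 x) + \tr (M2 x)) ->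
  alpha = (alpha1 + alpha2 : {ffun 'I_s -> nat} * {ffun 'I_t -> nat}).
Proof.
move: alpha alpha1 alpha2 => [p q] [p1 q1] [p2 q2] [Mp Mq] [M1p M1q] [M2p M2q] tr.
congr pair; apply/ffunP => i; rewrite ffunE.
  exact: (multiplicities_add V_simples ssS1 Mp M1p M2p (fun x => tr (g1 x))).
exact: (multiplicities_add W_simples ssS2 Mq M1q M2q (fun x => tr (g2 x))).
Qed.

Lemma simple_module_dim (B : falgType F) k (d : 'I_k -> nat) (X : forall i, rep B (d i)) i :
  simple_modules X -> (0 < d i)%N.
Proof. by move=> [Xs _ _]; have [] := Xs i. Qed.

(** Each multiplicity is at most n because simple modules have positive dimension, so the trace at x
    takes finitely many values on [rep A n] and is constant on connected sets. *)
Lemma simple_trace_connected (B : falgType F) k (d : 'I_k -> nat) (X : forall i, rep B (d i))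
    (g : {lrmorphism B -> A}) n (C : set (rep A n)) rho sigma x :
    semisimple_algebra B -> simple_modules X -> connected C -> C rho -> C sigma ->
  \tr (rho (g x)) = \tr (sigma (g x)).
Proof.
move=> ssB Xs Cconn Crho Csigma.
pose vals := [seq \sum_i \tr (X i x) *+ (p i : 'I_n.+1) | p : {ffun 'I_k -> 'I_n.+1}].
apply: (rep_polyfun_connected (f := fun rho => \tr (rho (g x))) (vals := vals)) Cconn Crho Csigma.
  exact: rep_polyfun_trace.
move=> tau; have [p tauX] := rep_iso_mult_sum (tau \o g) ssB Xs.
have pn i : (p i < n.+1)%N.
  rewrite ltnS (rep_iso_dim tauX) mult_sum_dim (bigD1 i) //=.
  by apply: leq_trans (leq_addr _ _); rewrite leq_pmull // (simple_module_dim _ Xs).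
apply/mapP; exists [ffun i => Ordinal (pn i)]; first by rewrite mem_enum.
rewrite (rep_iso_trace x tauX) mult_sum_trace.
by apply: eq_bigr => i _; rewrite ffunE.
Qed.

Lemma component_restriction_type n (M : rep A n) alpha : has_type M alpha ->
  component_of M = restriction_type g1 g2 V W alpha.
Proof.
move=> Malpha; have [en _] := has_type_dim Malpha.
move: M Malpha; rewrite {}en => M Malpha.
congr Symbol; apply/seteqP; split=> M'.
  move=> [C [CM _ Cconn] CM']; have [alpha' M'alpha'] := has_type_exists M'.
  have e : alpha' = alpha; last by rewrite e in M'alpha'.
  apply: has_type_unique M'alpha' Malpha _ _ => x.
    exact: (simple_trace_connected g1 x ssS1 V_simples Cconn CM' CM).
  exact: (simple_trace_connected g2 x ssS2 W_simples Cconn CM' CM).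
move=> [M'1 M'2]; have [M1 M2] := Malpha.
apply: (component_of_iso A_coprod).
  exact: rep_iso_trans M1 (rep_iso_sym M'1).
exact: rep_iso_trans M2 (rep_iso_sym M'2).
Qed.

(** Some decomposition over S exists by semi-simplicity; its multiplicities are then identified by
    comparing traces. *)
Lemma restricted_multiplicities (B : falgType F) (f : {lrmorphism S -> B}) k
    (d : 'I_k -> nat) (X : forall i, rep B (d i)) (e : 'I_r -> 'I_k -> nat) n
    (rho : rep B n) p :
    (forall i, rep_iso (fun x => X i (f x)) (mult_sum (fun k => U k) (fun k => e k i))) ->
    rep_iso rho (mult_sum (fun i => X i) p) ->
  rep_iso (fun x => rho (f x)) (mult_sum (fun k => U k) (fun k => \sum_i e k i * p i)%N).
Proof.
move=> X_res rhoX; have [c rhoU] := rep_iso_mult_sum (rho \o f) ssS U_simples.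
have ec : c = (fun k => \sum_i e k i * p i)%N; last by rewrite ec in rhoU.
apply/funext; apply: (multiplicities_inj U_simples ssS) => x.
have <- : \tr (mult_sum (fun k => U k) c x) = \sum_k \tr (U k x) *+ c k.
  by rewrite mult_sum_trace.
rewrite -(rep_iso_trace x rhoU) /= (rep_iso_trace (f x) rhoX) mult_sum_trace.
under [LHS]eq_bigr => i _ do rewrite (rep_iso_trace x (X_res i)) mult_sum_trace -sumrMnl.
rewrite exchange_big /=; apply: eq_bigr => j _.
by rewrite -sumrMnr; apply: eq_bigr => i _; rewrite mulrnA.
Qed.

(** The source is restricted to S through S1 and the target through S2. Hence only [alpha.1] and
    [alpha'.2] occur, as in the asymmetric term of the Euler form. *)
Lemma dim_hom_space_restricted n n' (X : rep A n) (X' : rep A n') alpha alpha' :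
    has_type X alpha -> has_type X' alpha' ->
  \dim (hom_space (fun x => X (g1 (f1 x))) (fun x => X' (g1 (f1 x)))) =
  (\sum_(i < s) \sum_(j < t) arrow_count a b i j * alpha.1 i * alpha'.2 j)%N.
Proof.
move=> [X1 _] [_ X'2]; have [gf _] := A_coprod.
have XU := restricted_multiplicities (rho := X \o g1) (f := f1) V_res X1.
have X'U := restricted_multiplicities (rho := X' \o g2) (f := f2) W_res X'2.
have -> : (fun x => X' (g1 (f1 x))) = (fun x => X' (g2 (f2 x))).
  by apply/funext => x; rewrite gf.
rewrite (dim_hom_space U_simples XU X'U).
under eq_bigr => k _ do rewrite big_distrl /=.
rewrite exchange_big /=; apply: eq_bigr => i _.
under eq_bigr => k _ do rewrite big_distrr /=.
rewrite exchange_big /=; apply: eq_bigr => j _.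
rewrite /arrow_count !big_distrl /=; apply: eq_bigr => k _.
by rewrite mulnACA mulnA.
Qed.

Lemma ext1_dim_euler n n' (X : rep A n) (X' : rep A n') alpha alpha' :
    has_type X alpha -> has_type X' alpha' ->
  exists2 d, ext1_dim X X' d &
    d%:Z = (\dim (hom_space X X'))%:Z
           - euler_form (arrow_count a b) (int_vector alpha) (int_vector alpha').
Proof.
move=> Xt X't; have [X1 X2] := Xt; have [X'1 X'2] := X't.
have [d [dP dE]] := ext1_dim_coproduct A_coprod ssS1 ssS2 X X'.
exists d => //; move: dE.
rewrite (dim_hom_space V_simples X1 X'1) (dim_hom_space W_simples X2 X'2).
rewrite (dim_hom_space_restricted Xt X't) => /(congr1 Posz).
rewrite !PoszD /euler_form /int_vector /= => dE.
have sum1 : \sum_(i < s) [ffun i => (alpha.1 i)%:Z] i * [ffun i => (alpha'.1 i)%:Z] i =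
    (\sum_i alpha.1 i * alpha'.1 i)%N%:Z.
  by rewrite -natz natr_sum; apply: eq_bigr => i _; rewrite !ffunE natz PoszM.
have sum2 : \sum_(i < t) [ffun j => (alpha.2 j)%:Z] i * [ffun j => (alpha'.2 j)%:Z] i =
    (\sum_i alpha.2 i * alpha'.2 i)%N%:Z.
  by rewrite -natz natr_sum; apply: eq_bigr => i _; rewrite !ffunE natz PoszM.
have sum0 : \sum_(i < s) \sum_(j < t) (arrow_count a b i j)%:Z
      * [ffun i => (alpha.1 i)%:Z] i * [ffun j => (alpha'.2 j)%:Z] j =
    (\sum_(i < s) \sum_(j < t) arrow_count a b i j * alpha.1 i * alpha'.2 j)%N%:Z.
  rewrite -natz natr_sum; apply: eq_bigr => i _; rewrite natr_sum.
  by apply: eq_bigr => j _; rewrite !ffunE natz !PoszM.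
rewrite sum1 sum2 sum0; move/eqP: dE; rewrite -addrA eq_sym -subr_eq => /eqP <-.
by rewrite opprB addrCA addrA.
Qed.

(** M1 acts on an invariant subspace Y, and M2 is the quotient by Y realized on a linear complement.
    Additivity of traces is all that the types require. *)
Lemma nonsimple_split n (M : rep A n) : (0 < n)%N -> ~ rep_simple M ->
  exists n1 n2 (M1 : rep A n1) (M2 : rep A n2),
    [/\ (0 < n1)%N, (0 < n2)%N & forall x, \tr (M x) = \tr (M1 x) + \tr (M2 x)].
Proof.
move=> n0 nsimple.
have [Y Yinv [Y0 Yfull]] : exists2 Y : {vspace 'cV[F]_n},
    (forall x v, v \in Y -> M x *m v \in Y) & Y <> 0%VS /\ Y <> fullv.
  apply: contrapT => nY; apply: nsimple; split=> // Y Yinv.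
  by apply: contrapT => /not_orP Y0f; apply: nY; exists Y.
have [q [q' [qi q'i' qi' q'i total]]] := vspace_split (addv_complf Y) (capv_compl Y).
have q'Mi x : q' *m M x *m basis_mx Y = 0.
  apply: mulmx_cV_inj => v; rewrite mul0mx -!mulmxA.
  have [z ->] := basis_mx_surj (Yinv x _ (basis_mx_mem v)).
  by rewrite mulmxA q'i mul0mx.
have Mi x : M x *m basis_mx Y = basis_mx Y *m (q *m M x *m basis_mx Y).
  by rewrite -[LHS]mul1mx -total mulmxDl -!mulmxA (mulmxA q') q'Mi mulmx0 addr0.
have q'M x : q' *m M x = q' *m M x *m basis_mx Y^C *m q'.
  by rewrite -[LHS]mulmx1 -total mulmxDr !mulmxA q'Mi mul0mx add0r.
have [|M1 M1E] := corner_rep (rho := M) qi.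
  by move=> x y; rewrite -(mulmxA _ (basis_mx Y)) -Mi !mulmxA.
have [|M2 M2E] := corner_rep (rho := M) q'i'.
  by move=> x y; rewrite !mulmxA -q'M.
exists (\dim Y), (\dim Y^C), M1, M2; split.
- by rewrite lt0n dimv_eq0; apply/eqP.
- rewrite lt0n dimv_eq0; apply/eqP => YC0; apply: Yfull.
  by rewrite -(addv_complf Y) YC0 addv0.
move=> x; rewrite M1E M2E -[M x in LHS]mulmx1 -total mulmxDr raddfD /=.
by rewrite !mulmxA; congr (_ + _); rewrite mxtrace_mulC mulmxA.
Qed.

(* The representation of the quiver records the S-linear maps from the V_i in M
   to the W_j of M in bases of the spaces Hom_S(V_i, W_j). A subrepresentation
   (P, Q) spans an S1-submodule of M inside an S2-submodule of M, of dimensions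
   \sum_i l_i dim P_i and \sum_j m_j dim Q_j. *)
Lemma comp_of_type n (M : rep A n) alpha :
  has_type M alpha -> comp_semigroup F (arrow_count a b) l m alpha.
Proof.
move=> Malpha; have [dim1 dim2] := has_type_dim Malpha.
split; first by rewrite -dim1 -dim2.
move: alpha Malpha {dim1 dim2} => [p q] [/= M1 M2].
have /decompositionP[iota [pi [orth iV pV total]]] := M1.
have /decompositionP[iota' [pi' [orth' iV' pV' total']]] := M2.
have [gf _] := A_coprod.
pose H i j := hom_space (fun x => V i (f1 x)) (fun x => W j (f2 x)).
(* The arrows from i to j are as many as the elements of [vbasis (H i j)]; arrow k records the
   coefficient of the k-th basis element. *)
have dimH i j : \dim (H i j) = arrow_count a b i j.
  exact: (dim_hom_space U_simples (V_res i) (W_res j)).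
have memH i j c d : pi' j d *m iota i c \in H i j.
  apply/hom_spaceP => x; have /= iVx := iV i c (f1 x); have /= pVx := pV' j d (f2 x).
  by rewrite -mulmxA iVx mulmxA gf pVx mulmxA.
have coords i j c d := vbasis_coords (dimH i j) (memH i j c d).
pose coef i j c d := projT1 (cid (coords i j c d)).
have coefE i j c d : pi' j d *m iota i c = \sum_k coef i j c d k *: (vbasis (H i j))`_k.
  by rewrite /coef; case: cid.
exists (fun i j k => \matrix_(d, c) coef i j c d k).
move=> [P [Q [PQ _]]]; apply/negP; rewrite -leNgt theta_dot_ge0.
pose L i := projT1 (cid (left_inverse_mx (@basis_mx_inj _ _ (P i)))).
have LE i : L i *m basis_mx (P i) = 1%:M by rewrite /L; case: cid.
pose L' j := projT1 (cid (left_inverse_mx (@basis_mx_inj _ _ (Q j)))).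
have L'E j : L' j *m basis_mx (Q j) = 1%:M by rewrite /L'; case: cid.
apply: (biorthonormal_le (biorthonormal_sub orth LE)
  (pi' := fun j e => \sum_d L' j e d *: pi' j d)
  (iota' := fun j e => \sum_d basis_mx (Q j) d e *: iota' j d)) => i c.
pose phi j k : 'M[F]_(q j, p i) := \matrix_(d, c) coef i j c d k.
pose Y j d := \sum_k (phi j k *m basis_mx (P i)) d c *: (vbasis (H i j))`_k.
have YE j d : pi' j d *m (\sum_x basis_mx (P i) x c *: iota i x) = Y j d.
  rewrite mulmx_sumr /Y; under eq_bigr => x _ do rewrite -scalemxAr coefE scaler_sumr.
  rewrite exchange_big /=; apply: eq_bigr => k _; rewrite mxE scaler_suml.
  by apply: eq_bigr => x _; rewrite scalerA [phi _ _ _ _]mxE mulrC.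
(* [basis_mx (Q j) *m L' j] is a projection onto [Q j]. It fixes the columns of
   [phi j k *m basis_mx (P i)] for every arrow k, which is the subrepresentation condition, and so
   reproduces the vector-valued [Y j]. *)
have QY j d : \sum_e basis_mx (Q j) d e *: (\sum_x L' j e x *: Y j x) = Y j d.
  have fixed k : basis_mx (Q j) *m L' j *m (phi j k *m basis_mx (P i)) =
      phi j k *m basis_mx (P i).
    apply: mulmx_cV_inj => v; rewrite -[phi j k *m _ *m v]mulmxA -!mulmxA.
    have [z ->] := basis_mx_surj (PQ i j k _ (basis_mx_mem v)).
    by rewrite !mulmxA -(mulmxA (basis_mx _)) L'E mulmx1.
  rewrite /Y; under [RHS]eq_bigr => k _ do rewrite -fixed -mulmxA mxE scaler_suml.
  rewrite [RHS]exchange_big /=; apply: eq_bigr => e _.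
  under eq_bigr => x _ do rewrite scaler_sumr.
  rewrite exchange_big scaler_sumr /=; apply: eq_bigr => k _.
  rewrite -scalerA; congr (_ *: _); rewrite [in RHS]mxE scaler_suml.
  by apply: eq_bigr => x _; rewrite scalerA.
rewrite -[RHS]mul1mx -total' !mulmx_suml; apply: eq_bigr => j _.
rewrite !mulmx_suml.
under [RHS]eq_bigr => d _ do rewrite -mulmxA YE -QY mulmx_sumr.
rewrite [RHS]exchange_big /=; apply: eq_bigr => e _.
rewrite -mulmxA mulmx_suml; apply: eq_bigr => d _.
rewrite -scalemxAl -scalemxAr; congr (_ *: (_ *m _)).
by rewrite mulmx_suml; apply: eq_bigr => x _; rewrite -scalemxAl YE.
Qed.

End RestrictionTypes.

(** * The quiver setting *)

Section Generators.

(** If x were 0 or a sum of two non-zero elements of D, then D without x would still generate D, and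
    leastness of G would exclude x from G. Cancellation ensures that neither summand is x itself. *)
Lemma generator_indecomposable (T : nmodType) (D G : set T) x :
    right_injective (+%R : T -> T -> T) ->
    semigroup_generators 0 (fun x y z => x + y = z) D G -> G x ->
  x <> 0 /\ forall y z, D y -> D z -> x = y + z -> y = 0 \/ z = 0.
Proof.
move=> cancel [GD Dgen Gleast] Gx.
have least : ~ (D `<=` generated 0 (fun x y z => x + y = z) (D `\ x)).
  move=> Dgen'; have [|_] := Gleast (D `\ x) _ Dgen' x Gx; last by apply.
  by move=> z [].
split=> [x0|y z Dy Dz xyz].
  apply: least => z Dz; have [->|zx] := pselect (z = x); last exact: generated_mem.
  by rewrite x0; apply: generated_zero.
apply: contrapT => /not_orP[y0 z0]; apply: least => w Dw.
have [->|wx] := pselect (w = x); last exact: generated_mem.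
apply: (generated_add (x := y) (y := z)); last by rewrite xyz.
  apply: generated_mem; split=> // yx; apply: z0; apply: (cancel y).
  by rewrite addr0 -xyz.
apply: generated_mem; split=> // zx; apply: y0; apply: (cancel z).
by rewrite addr0 addrC -xyz.
Qed.

(** Addition is only a relation, so [phi] must carry sums forward and lift them back. Leastness is
    checked by pulling a generating set G' of the image back to the elements of D that [phi] sends
    into G'. *)
Lemma semigroup_generators_image (T T' : Type) zero zero' add add' (D G : set T)
    (D' : set T') (phi : T -> T') :
    zero' = phi zero -> D zero -> D' = phi @` D ->
    (forall x y, D x -> D y -> phi x = phi y -> x = y) ->
    (forall x y z, D x -> D y -> add x y z -> D z /\ add' (phi x) (phi y) (phi z)) ->
    (forall x y w, D x -> D y -> add' (phi x) (phi y) w ->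
       exists z, [/\ D z, w = phi z & add x y z]) ->
  semigroup_generators zero add D G -> semigroup_generators zero' add' D' (phi @` G).
Proof.
move=> -> D0 -> phi_inj phi_add phi_addV [GD Dgen Gleast]; split.
- by move=> _ [x Gx <-]; exists x => //; apply: GD.
- have genphi x : generated zero add G x ->
      D x /\ generated (phi zero) add' (phi @` G) (phi x).
    elim=> [|{}x Gx|{}x y z _ [Dx gx] _ [Dy gy] xyz].
    + by split=> //; apply: generated_zero.
    + by split; [apply: GD | apply: generated_mem; exists x].
    + have [Dz z'] := phi_add _ _ _ Dx Dy xyz.
      by split=> //; apply: generated_add z'.
  by move=> _ [x Dx <-]; have [] := genphi x (Dgen x Dx).
move=> G' G'D gen'; pose G'' := [set x | D x /\ G' (phi x)].
have lift w : generated (phi zero) add' G' w ->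
    exists x, [/\ D x, w = phi x & generated zero add G'' x].
  elim=> [|{}w G'w|x y z _ [x' [Dx' -> gx']] _ [y' [Dy' -> gy']] xyz].
  - by exists zero; split=> //; apply: generated_zero.
  - have [x Dx xw] := G'D w G'w; exists x; split=> //.
    by apply: generated_mem; split=> //; rewrite xw.
  - have [z' [Dz' -> xyz']] := phi_addV _ _ _ Dx' Dy' xyz.
    by exists z'; split=> //; apply: generated_add xyz'.
have DG'' : D `<=` generated zero add G''.
  move=> x Dx; have [|x' [Dx' e gx']] := lift (phi x); first by apply: gen'; exists x.
  by rewrite (phi_inj _ _ Dx Dx' e).
move=> _ [x Gx <-].
by have [|_] := Gleast G'' _ DG'' x Gx => // y [].
Qed.

End Generators.

Lemma dimension_vector_addI s t :
  right_injective (+%R : {ffun 'I_s -> nat} * {ffun 'I_t -> nat} -> _ -> _).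
Proof.
move=> [p q] [p1 q1] [p2 q2] [/ffunP ep /ffunP eq]; congr pair; apply/ffunP => i.
  by have := ep i; rewrite !ffunE => /addnI.
by have := eq i; rewrite !ffunE => /addnI.
Qed.

Lemma trace_dsum (F : fieldType) (A : algType F) n n' (X : rep A n) (X' : rep A n') x :
  \tr (rep_dsum X X' x) = \tr (X x) + \tr (X' x).
Proof. exact: mxtrace_block. Qed.

Lemma dim_hom_space_simple (F : closedFieldType) (A : algType F) n (X : rep A n) :
  rep_simple X -> \dim (hom_space X X) = 1%N.
Proof.
move=> Xs; have [n0 _] := Xs.
have -> : hom_space X X = <[1%:M]>%VS.
  apply/vspaceP => T; apply/idP/vlineP => [/hom_spaceP/(schur_scalar Xs)[c ->]|[c ->]].
    by exists c; rewrite scale_scalar_mx mulr1.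
  apply/hom_spaceP => x; rewrite -scalemxAl -scalemxAr mul1mx.
  by rewrite mulmx1.
rewrite dim_vline; case: eqP => // /matrixP/(_ (Ordinal n0) (Ordinal n0)).
by rewrite !mxE eqxx => /eqP; rewrite oner_eq0.
Qed.

Section QuiverSetting.
Variables (F : numClosedFieldType) (S S1 S2 : falgType F) (A : algType F).
Variables (f1 : {lrmorphism S -> S1}) (f2 : {lrmorphism S -> S2}).
Variables (g1 : {lrmorphism S1 -> A}) (g2 : {lrmorphism S2 -> A}).
Hypothesis ssS : semisimple_algebra S.
Hypothesis ssS1 : semisimple_algebra S1.
Hypothesis ssS2 : semisimple_algebra S2.
Hypothesis A_coprod : amalgamated_coproduct f1 f2 g1 g2.
Variables (r s t : nat) (u : 'I_r -> nat) (U : forall k, rep S (u k)).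
Variables (l : 'I_s -> nat) (V : forall i, rep S1 (l i)).
Variables (m : 'I_t -> nat) (W : forall j, rep S2 (m j)).
Hypotheses (U_simples : simple_modules U) (V_simples : simple_modules V).
Hypothesis W_simples : simple_modules W.
Variables (a : 'I_r -> 'I_s -> nat) (b : 'I_r -> 'I_t -> nat).
Hypothesis V_res : forall i,
  rep_iso (fun x => V i (f1 x)) (mult_sum (fun k => U k) (fun k => a k i)).
Hypothesis W_res : forall j,
  rep_iso (fun x => W j (f2 x)) (mult_sum (fun k => U k) (fun k => b k j)).

Local Notation T := ({ffun 'I_s -> nat} * {ffun 'I_t -> nat})%type.
Local Notation comp := (comp_semigroup F (arrow_count a b) l m).
Local Notation typed := (has_type g1 g2 V W).
Local Notation phi := (restriction_type g1 g2 V W).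

Hypothesis comp_occurs : forall alpha : dimension_vector s t,
  comp alpha -> symbol_set (phi alpha) !=set0.

Let type_comp n (M : rep A n) alpha : typed M alpha -> comp alpha :=
  @comp_of_type _ _ _ _ _ _ _ _ _ A_coprod _ _ _ _ _ _ _ _ _ U_simples _ _ V_res W_res _ M alpha.

Lemma comp_component alpha : comp alpha ->
  exists n (M : rep A n), typed M alpha /\ component_of M = phi alpha.
Proof.
move=> /comp_occurs[M Malpha]; exists (\sum_(i < s) l i * alpha.1 i)%N, M.
by split=> //; apply: (component_restriction_type ssS1 ssS2 A_coprod).
Qed.

Lemma restriction_type_inj (alpha alpha' : dimension_vector s t) :
  comp alpha -> phi alpha = phi alpha' -> alpha = alpha'.
Proof.
move=> /comp_occurs[M Malpha] e.
(* Equal symbols have sizes that agree only propositionally; quantifying over [sigma] carries M to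
   the other type without a cast. *)
have mem sigma : sigma = phi alpha' -> forall N, symbol_set sigma N -> typed N alpha'.
  by move=> ->.
exact: (has_type_unique ssS1 ssS2 V_simples W_simples Malpha (mem _ e M Malpha)).
Qed.

Lemma type_eq0 n (M : rep A n) alpha : typed M alpha -> n = 0%N -> alpha = (0 : T).
Proof.
move=> Malpha n0; have [] := has_type_dim Malpha; rewrite n0.
move: alpha {Malpha} => [p q] /= /esym/eqP; rewrite sum_nat_eq0 => /forallP p0.
move=> /esym/eqP; rewrite sum_nat_eq0 => /forallP q0.
congr pair; apply/ffunP => i; rewrite ffunE; apply/eqP.
  by have := p0 i; rewrite muln_eq0 eqn0Ngt (simple_module_dim _ V_simples).
by have := q0 i; rewrite muln_eq0 eqn0Ngt (simple_module_dim _ W_simples).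
Qed.

Lemma type0_dim n (M : rep A n) : typed M (0 : T) -> n = 0%N.
Proof.
case/has_type_dim=> + _; rewrite big1 // => i _.
by rewrite ffunE muln0.
Qed.

Lemma component_semigroup_generators (G : set T) :
    semigroup_generators (0 : T) (fun x y z => x + y = z) comp G ->
  semigroup_generators (component_of (rep_zero A)) (@symbol_add F A)
    (@component_symbol F A) (phi @` G).
Proof.
have [alpha0 Malpha0] := has_type_exists g1 g2 ssS1 ssS2 V_simples W_simples (rep_zero A).
have zero_type : typed (rep_zero A) (0 : T) by rewrite -(type_eq0 Malpha0 erefl).
have dsum_type n n' (X : rep A n) (X' : rep A n') alpha alpha' :
    typed X alpha -> typed X' alpha' -> typed (rep_dsum X X') (alpha + alpha' : T).
  move=> Xt X't.
  have [alpha'' XX't] := has_type_exists g1 g2 ssS1 ssS2 V_simples W_simples (rep_dsum X X').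
  rewrite -(has_type_add ssS1 ssS2 V_simples W_simples XX't Xt X't) // => x.
  exact: trace_dsum.
have compE n (X : rep A n) alpha : typed X alpha -> component_of X = phi alpha.
  exact: (component_restriction_type ssS1 ssS2 A_coprod).
have typedE n (X : rep A n) alpha : comp alpha -> component_of X = phi alpha -> typed X alpha.
  move=> Calpha e.
  have [alpha' Xt] := has_type_exists g1 g2 ssS1 ssS2 V_simples W_simples X.
  by rewrite (restriction_type_inj Calpha (_ : _ = phi alpha')) // -e (compE _ _ _ Xt).
apply: semigroup_generators_image.
- exact: compE zero_type.
- exact: type_comp zero_type.
- apply/seteqP; split=> [_ [n [X ->]]|_ [alpha /comp_component[n [X [_ <-]]] <-]].
    have [alpha Xt] := has_type_exists g1 g2 ssS1 ssS2 V_simples W_simples X.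
    by exists alpha; [apply: type_comp Xt | rewrite (compE _ _ _ Xt)].
  by exists n, X.
- by move=> alpha alpha' Calpha _; apply: restriction_type_inj.
- move=> x y _ /comp_component[n [X [Xt eX]]] /comp_component[n' [X' [X't eX']]] <-.
  split; first exact: type_comp (dsum_type _ _ _ _ _ _ Xt X't).
  exists n, n', X, X'; rewrite eX eX'; split=> //.
  exact/esym/compE/dsum_type.
move=> x y _ Cx Cy [n [n' [X [X' [eX eX' ->]]]]].
have Xt := typedE _ _ _ Cx (esym eX); have X't := typedE _ _ _ Cy (esym eX').
exists (x + y); split=> //; first exact: type_comp (dsum_type _ _ _ _ _ _ Xt X't).
exact/compE/dsum_type.
Qed.

Variables (k : nat) (beta : 'I_k -> dimension_vector s t).
Hypothesis beta_inj : injective beta.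
Hypothesis beta_gens :
  semigroup_generators (0 : T) (fun x y z => x + y = z) comp (range beta).

Lemma generator_simple v n (X : rep A n) : typed X (beta v) -> rep_simple X.
Proof.
have beta_v : range beta (beta v) by exists v.
have [beta0 indec] := generator_indecomposable (@dimension_vector_addI s t) beta_gens beta_v.
move=> Xt; apply: contrapT => nsimple.
have n0 : (0 < n)%N by rewrite lt0n; apply/eqP => /(type_eq0 Xt).
have [n1 [n2 [X1 [X2 [n1_gt0 n2_gt0 tr]]]]] := nonsimple_split n0 nsimple.
have [alpha1 X1t] := has_type_exists g1 g2 ssS1 ssS2 V_simples W_simples X1.
have [alpha2 X2t] := has_type_exists g1 g2 ssS1 ssS2 V_simples W_simples X2.
have := has_type_add ssS1 ssS2 V_simples W_simples Xt X1t X2t tr.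
case/(indec _ _ (type_comp X1t) (type_comp X2t)) => e0.
  by rewrite e0 in X1t; rewrite (type0_dim X1t) in n1_gt0.
by rewrite e0 in X2t; rewrite (type0_dim X2t) in n2_gt0.
Qed.

(** The value does not depend on the choice of the family X. For i != j a non-zero intertwiner would
    be invertible by Schur's lemma, so the traces, hence the types [beta i] and [beta j], would
    coincide. *)
Lemma generator_ext (X : forall v, rep A (symbol_dim (phi (beta v)))) i j :
    (forall v, symbol_set (phi (beta v)) (X v)) ->
  exists2 d, ext1_dim (X i) (X j) d &
    d%:Z = (i == j)%:Z - euler_form (arrow_count a b)
                           (int_vector (beta i)) (int_vector (beta j)).
Proof.
move=> Xt; have Xs v : rep_simple (X v) by apply: (@generator_simple v); apply: Xt.
have [d dP dE] := ext1_dim_euler ssS ssS1 ssS2 A_coprod U_simples V_simples W_simples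
  V_res W_res (Xt i) (Xt j).
exists d => //; rewrite dE; congr (_%:Z - _).
have [<-|ij] := eqVneq i j; first exact: (dim_hom_space_simple (Xs i)).
apply/eqP; rewrite dimv_eq0 -subv0; apply/subvP => T /hom_spaceP TX.
rewrite memv0; apply: contraNT ij => T0; apply/eqP/beta_inj.
have [C [CT TC]] := schur (Xs i) (Xs j) TX T0.
have Xij : rep_iso (X i) (X j) by exists T, C.
by apply: (has_type_unique ssS1 ssS2 V_simples W_simples (Xt i) (Xt j)) => x;
   apply: (rep_iso_trace _ Xij).
Qed.

Lemma quiver_setting_exists :
  exists Q : quiver_setting k,
    [/\ is_quiver_setting (fun i => phi (beta i)) Q,
        forall i j, (arrows Q i j)%:Z =
          (i == j)%:Z - euler_form (arrow_count a b)
                          (int_vector (beta i)) (int_vector (beta j)) &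
        forall i, dimvec Q i = (\sum_(j < s) l j * (beta i).1 j)%N].
Proof.
have comp_beta v : comp (beta v) by have [sub _ _] := beta_gens; apply: sub; exists v.
pose X v := projT1 (cid (comp_occurs (comp_beta v))).
have Xt v : symbol_set (phi (beta v)) (X v) by rewrite /X; case: cid.
pose chi i j := (i == j)%:Z - euler_form (arrow_count a b)
                                (int_vector (beta i)) (int_vector (beta j)).
have extE Y i j : (forall v, symbol_set (phi (beta v)) (Y v)) ->
    ext1_dim (Y i) (Y j) `|chi i j|%N.
  by move=> Yt; have [d dP dE] := generator_ext i j Yt; rewrite /chi -dE.
(* [chi i j] is the dimension of an Ext^1, hence non-negative; the absolute value only moves it from
   [int] to [nat]. *)
exists (QuiverSetting (fun i j => `|chi i j|%N) (fun i => symbol_dim (phi (beta i)))).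
split=> // [|i j]; last by have [d _ dE] := generator_ext i j Xt; rewrite /= /chi -dE.
split=> //.
- move=> i j e; apply: beta_inj; exact: restriction_type_inj e.
- have -> : range (fun i => phi (beta i)) = phi @` range beta.
    apply/seteqP; split=> [_ [v _ <-]|_ [_ [v _ <-] <-]]; last by exists v.
    by exists (beta v) => //; exists v.
  exact: component_semigroup_generators.
move=> i j; split=> /=; first by exists X; split=> //; apply: extE.
by move=> d [Y [Yt dP]]; rewrite (ext1_dim_unique dP (extE Y i j Yt)).
Qed.

End QuiverSetting.

Theorem theorem1 (R : realType)
    (S S1 S2 : falgType R[i]) (A : algType R[i])
    (f1 : {lrmorphism S -> S1}) (f2 : {lrmorphism S -> S2})
    (g1 : {lrmorphism S1 -> A}) (g2 : {lrmorphism S2 -> A})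
    (ssS : semisimple_algebra S) (ssS1 : semisimple_algebra S1)
    (ssS2 : semisimple_algebra S2)
    (f1_inj : injective f1) (f2_inj : injective f2)
    (A_coprod : amalgamated_coproduct f1 f2 g1 g2)
    (r s t : nat)
    (u : 'I_r -> nat) (U : forall k, rep S (u k))
    (l : 'I_s -> nat) (V : forall i, rep S1 (l i))
    (m : 'I_t -> nat) (W : forall j, rep S2 (m j))
    (U_simples : simple_modules U) (V_simples : simple_modules V)
    (W_simples : simple_modules W)
    (a : 'I_r -> 'I_s -> nat) (b : 'I_r -> 'I_t -> nat)
    (V_res : forall i,
       rep_iso (fun x => V i (f1 x)) (mult_sum (fun k => U k) (fun k => a k i)))
    (W_res : forall j,
       rep_iso (fun x => W j (f2 x)) (mult_sum (fun k => U k) (fun k => b k j)))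
    (comp_occurs : forall alpha : dimension_vector s t,
       comp_semigroup R[i] (arrow_count a b) l m alpha ->
       symbol_set (restriction_type g1 g2 V W alpha) !=set0)
    (k : nat) (beta : 'I_k -> dimension_vector s t)
    (beta_inj : injective beta)
    (beta_gens : semigroup_generators (0 : {ffun 'I_s -> nat} * {ffun 'I_t -> nat})
       (fun x y z => x + y = z) (comp_semigroup R[i] (arrow_count a b) l m) (range beta)) :
  exists Q : quiver_setting k,
    [/\ is_quiver_setting (fun i => restriction_type g1 g2 V W (beta i)) Q,
        forall i j, (arrows Q i j)%:Z =
          (i == j)%:Z - euler_form (arrow_count a b)
                          (int_vector (beta i)) (int_vector (beta j)) &
        forall i, dimvec Q i = (\sum_(j < s) l j * (beta i).1 j)%N].
Proof.
exact: (quiver_setting_exists ssS ssS1 ssS2 A_coprod U_simples V_simples W_simples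
  V_res W_res comp_occurs beta_inj beta_gens).
Qed.
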